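(* Let $\{e_k\}_{k\geq 0}$ be an orthonormal sequence in $L^2(\mathbb{R})$. Then for all $n\geq 0$, $$ \sum_{k=0}^n \left( \Delta^2(e_k) + \Delta^2(\widehat{e_k}) + |\mu(e_k)|^2 + |\mu(\widehat{e_k})|^2 \right) \geq \frac{(n+1)^2}{2\pi}. $$ Moreover, if $n_0\geq 0$ and equality holds for all $0\leq n\leq n_0$, then for each $k=0,\ldots,n_0$ there is $c_k\in\mathbb{C}$ with $|c_k|=1$ such that $e_k=c_kh_k$, where $h_k$ is the $k$-th Hermite function.
   Context: The Fourier transform is $\widehat{f}(\xi)=\int_{\mathbb{R}} f(x)e^{-2i\pi x\xi}\,dx$ for $f\in L^1(\mathbb{R})\cap L^2(\mathbb{R})$, extended to $L^2(\mathbb{R})$ as usual. For nonzero $f\in L^2(\mathbb{R})$, the mean is $\mu(f)=\frac{1}{\|f\|_2^2}\int_{\mathbb{R}} t|f(t)|^2\,dt$, the variance is $\Delta^2(f)=\int_{\mathbb{R}} |t-\mu(f)|^2|f(t)|^2\,dt$, and the dispersion is $\Delta(f)=\sqrt{\Delta^2(f)}$. Convention: if $\int_{\mathbb{R}} t^2|f(t)|^2\,dt=+\infty$, then $\Delta^2(f)=+\infty$, and the left-hand side of the inequality is $+\infty$ whenever one of its terms is. The Hermite functions are $$ h_k(t)=\frac{2^{1/4}}{\sqrt{k!}}\left(-\frac{1}{2\sqrt{\pi}}\right)^k e^{\pi t^2}\left(\frac{d}{dt}\right)^k e^{-2\pi t^2},\qquad k\geq 0, $$ which form an orthonormal basis of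 $L^2(\mathbb{R})$. *)

(* Defs.v *)
From HB Require Import structures.
From mathcomp Require Import all_boot all_order all_algebra.
From mathcomp Require Import complex.
From mathcomp Require Import all_classical all_reals all_analysis.
Set Implicit Arguments.
Unset Strict Implicit.
Unset Printing Implicit Defensive.
Import Order.TTheory GRing.Theory Num.Theory.
Import numFieldNormedType.Exports.

Local Open Scope classical_set_scope.
Local Open Scope complex_scope.
Local Open Scope ring_scope.

(* Elements of L^p(R) are represented by Borel functions R -> R[i]; equality in
   L^p(R) is equality almost everywhere. *)
Section FourierDispersion.
Context {R : realType}.
Implicit Types f g : R -> R[i].

Local Notation mu := (@lebesgue_measure R).

(* The modulus as an element of R (on R[i], `|z| is itself of type R[i]). *)
Definition modulus (z : R[i]) : R := ComplexField.Normc.normc z.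

Definition cmeasurable f : Prop :=
  measurable_fun [set: R] (fun x => complex.Re (f x)) /\
  measurable_fun [set: R] (fun x => complex.Im (f x)).

(* The extended real p is meant to be 1 or 2. *)
Definition cLnorm (p : \bar R) f : \bar R :=
  Lnorm mu p (fun x => (modulus (f x))%:E).

Definition in_Lp (p : \bar R) f : Prop :=
  cmeasurable f /\ (cLnorm p f < +oo)%E.

Definition cintegral f : R[i] :=
  (\int[mu]_x complex.Re (f x))%R +i* (\int[mu]_x complex.Im (f x))%R.

Definition inner f g : R[i] := cintegral (fun x => f x * (g x)^*).

Definition orthonormal_seq (e : nat -> R -> R[i]) : Prop :=
  (forall k, in_Lp 2%:E (e k)) /\
  (forall j k, inner (e j) (e k) = (j == k)%:R).

(* expi x = e^{i x} *)
Definition expi (x : R) : R[i] := cos x +i* sin x.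

Definition fourier_integral f (xi : R) : R[i] :=
  cintegral (fun x => f x * expi (- (2 * pi * x * xi))).

(* g represents the Fourier transform of f in L^2(R): the closure in
   L^2 x L^2 of the graph of the integral transform on the intersection of
   L^1 and L^2. *)
Definition is_fourier f g : Prop :=
  in_Lp 2%:E g /\
  exists u : nat -> R -> R[i],
    [/\ forall m, in_Lp 1%:E (u m) /\ in_Lp 2%:E (u m),
        (fun m => cLnorm 2%:E (fun x => u m x - f x)) @ \oo --> 0%E &
        (fun m => cLnorm 2%:E (fun xi => fourier_integral (u m) xi - g xi))
          @ \oo --> 0%E].

(* A chosen representative. By Plancherel's theorem one exists for every f in
   L^2(R), unique up to equality almost everywhere. *)
Definition fourier f : R -> R[i] := xget (fun=> 0) [set g | is_fourier f g].

Definition mean f : R :=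
  (\int[mu]_t (modulus (f t) ^+ 2))^-1 * \int[mu]_t (t * modulus (f t) ^+ 2).

(* For f in L^2(R), mean f is always a real number (an arbitrary one when
   t |f t|^2 is not integrable), so dispersion_sq f = +oo exactly when
   t^2 |f t|^2 has infinite integral. *)
Definition dispersion_sq f : \bar R :=
  (\int[mu]_t (`|t - mean f| ^+ 2 * modulus (f t) ^+ 2)%:E)%E.

Definition hermite_fun (k : nat) (t : R) : R :=
  2 `^ 4^-1 / Num.sqrt k`!%:R * (- (2 * Num.sqrt pi)^-1) ^+ k
  * expR (pi * t ^+ 2)
  * derive1n k (fun s : R => expR (- (2 * pi * s ^+ 2))) t.

End FourierDispersion.

(* Main.v *)
Require Import Defs.
From HB Require Import structures.
From mathcomp Require Import all_boot all_order all_algebra.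
From mathcomp Require Import complex.
From mathcomp Require Import all_classical all_reals all_analysis.
From mathcomp Require Import measurable_realfun ring lra.
Import Order.TTheory GRing.Theory Num.Theory.
Import numFieldNormedType.Exports.

Set Implicit Arguments.
Unset Strict Implicit.
Unset Printing Implicit Defensive.

Local Open Scope classical_set_scope.
Local Open Scope complex_scope.
Local Open Scope ring_scope.

(* The quantity attached to a unit vector f is its energy
   ||t f||^2 + ||xi f^||^2, the means cancelling the centrings of the variances.
   Write f = u + i v and let H be the Hartley transform, whose kernel
   cas = cos + sin is real.  After symmetrising in the frequency,
   |f^|^2 = |Hu|^2 + |Hv|^2, so everything reduces to real functions.
   The Hermite functions satisfy a three-term recurrence
   t h_j = al_j h_(j+1) + al_(j-1) h_(j-1) and H h_j = +- h_j.  Hence Bessel's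
   inequality applied to t u and to xi (Hu) bounds the energy of u below by
   sum_j (2j+1)/(2 pi) <u, h_j>^2, with no differentiation of u.

   Parseval for the h_j: the functions gauss(t) cas(2 pi xi t) satisfy it exactly
   (their squared coefficients are Poisson weights), so the residuals of an
   arbitrary u, multiplied by the Gaussian, have Hartley transforms tending to 0
   boundedly and pointwise.  They are therefore asymptotically orthogonal to
   gauss * (heat regularisations), and these are dense by Lebesgue's
   differentiation theorem.

   With Parseval, the energy of a unit vector f is at least
   lam_N - sum_(j<N) (lam_N - lam_j) |<f, h_j>|^2 for every N; summing over
   e_0, ..., e_n with N = n+1 and using Bessel for the e_k gives the bound, and
   taking N = k+1 shows |<e_k, h_k>| = 1 in the equality case. *)

(** * Square-integrable real functions *)

Section RealL2.
Context {R : realType}.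
Implicit Types f g h : R -> R.
Local Notation mu := (@lebesgue_measure R).

(** [is_fourier] is a closure in L2 and [fourier] picks an arbitrary representative, so the
    transform of a general function is not given by a formula. The obstacle is sidestepped: if the
    second moment of f is infinite, the bound is trivial; if it is finite, f is integrable because 1
    / (1 + t^2) is, and then [fourier f] is the Fourier integral almost everywhere. Transforms are
    thus only analysed on L1.

    Parseval serves twice. It yields the norm of f^, needed because variance plus squared mean
    equals the second moment for unit vectors, whereas the heat regularisation alone gives only an
    inequality. It also says that the mass of f missing from the modes j < N sits in modes of
    eigenvalue at least lam_N, whence the gap form of the lower bound.

    The numbers lam_j = (2j+1)/(2 pi) are the energies of the h_j; the first n+1 of them add up to
    (n+1)^2/(2 pi). *)

Lemma aeS (P Q : R -> Prop) : (forall x, P x -> Q x) ->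
  {ae mu, forall x, P x} -> {ae mu, forall x, Q x}.
Proof.
move=> PQ; apply: (@filterS _ _ (ae_filter_ringOfSetsType mu)); exact: PQ.
Qed.

Lemma aeI (P Q : R -> Prop) : {ae mu, forall x, P x} ->
  {ae mu, forall x, Q x} -> {ae mu, forall x, P x /\ Q x}.
Proof. by apply: (@filterS2 _ _ (ae_filter_ringOfSetsType mu)) => x. Qed.

Definition L1 f : Prop := mu.-integrable [set: R] (EFin \o f).

Definition sqint f : Prop :=
  measurable_fun [set: R] f /\ L1 (fun x => f x ^+ 2).

Definition ip f g : R := \int[mu]_x (f x * g x).

Lemma L1_measurable f : L1 f -> measurable_fun [set: R] f.
Proof. by move=> /(measurable_int mu)/measurable_EFinP. Qed.

Lemma eq_L1 f g : f =1 g -> L1 f -> L1 g.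
Proof. by move=> fg; apply: eq_integrable => // x _; rewrite /= fg. Qed.

Lemma L1_le f g : measurable_fun [set: R] f -> (forall x, `|f x| <= g x) ->
  L1 g -> L1 f.
Proof.
move=> mf fg; apply: le_integrable => //; first exact/measurable_EFinP.
by move=> x _ /=; rewrite lee_fin (le_trans (fg x)) ?ler_norm.
Qed.

Lemma L1Z a f : L1 f -> L1 (fun x => a * f x).
Proof. by move=> lf; apply: eq_integrable (integrableZl measurableT a lf). Qed.

Lemma L1D f g : L1 f -> L1 g -> L1 (fun x => f x + g x).
Proof. by move=> lf lg; apply: eq_integrable (integrableD measurableT lf lg). Qed.

Lemma L1B f g : L1 f -> L1 g -> L1 (fun x => f x - g x).
Proof. by move=> lf lg; apply: eq_integrable (integrableB measurableT lf lg). Qed.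

Lemma L1_norm f : L1 f -> L1 (fun x => `|f x|).
Proof. by move=> lf; apply: eq_integrable (integrable_abse lf). Qed.

Lemma L1_0 : L1 (fun=> 0).
Proof. exact: integrable0. Qed.

Lemma L1M_bounded (b : R -> R) f (C : R) : measurable_fun [set: R] b ->
  (forall x, `|b x| <= C) -> L1 f -> L1 (fun x => b x * f x).
Proof.
move=> mb bC lf; apply: (@L1_le _ (fun x => C * `|f x|)).
- by apply: measurable_funM => //; exact: L1_measurable.
- by move=> x; rewrite normrM ler_wpM2r.
- exact/L1Z/L1_norm.
Qed.

Lemma eq_sqint f g : f =1 g -> sqint f -> sqint g.
Proof. by move=> /funext ->. Qed.

Lemma sqintM f g : sqint f -> sqint g -> L1 (fun x => f x * g x).
Proof.
move=> [mf f2] [mg g2].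
apply: (@L1_le _ (fun x => f x ^+ 2 + g x ^+ 2)); last exact: L1D.
  exact: measurable_funM.
move=> x; rewrite normrM -(real_normK (num_real (f x))).
rewrite -(real_normK (num_real (g x))).
by have := normr_ge0 (f x); have := normr_ge0 (g x); nra.
Qed.

Lemma sqint_le f g : measurable_fun [set: R] f -> (forall x, `|f x| <= `|g x|) ->
  sqint g -> sqint f.
Proof.
move=> mf fg [mg g2]; split => //; apply: L1_le g2.
  exact: measurable_funX.
by move=> x; rewrite normrX -(real_normK (num_real (g x))) lerXn2r ?nnegrE.
Qed.

Lemma sqintZ a f : sqint f -> sqint (fun x => a * f x).
Proof.
move=> [mf f2]; split; first exact: measurable_funM.
by apply: eq_L1 (L1Z (a ^+ 2) f2) => x; rewrite exprMn.
Qed.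

Lemma sqintD f g : sqint f -> sqint g -> sqint (fun x => f x + g x).
Proof.
move=> lf lg; split; first by apply: measurable_funD; [case: lf | case: lg].
apply: eq_L1 (L1D (L1D lf.2 (L1Z 2 (sqintM lf lg))) lg.2) => x; ring.
Qed.

Lemma sqintB f g : sqint f -> sqint g -> sqint (fun x => f x - g x).
Proof.
by move=> lf lg; apply: eq_sqint (sqintD lf (sqintZ (-1) lg)) => x; rewrite mulN1r.
Qed.

Lemma sqint0 : sqint (fun=> 0).
Proof. by split => //; apply: eq_L1 L1_0 => x; rewrite expr0n. Qed.

Lemma sqint_sum n (F : nat -> R -> R) : (forall i, sqint (F i)) ->
  sqint (fun x => \sum_(i < n) F i x).
Proof.
move=> lF; elim: n => [|n IH].
  by apply: eq_sqint sqint0 => x; rewrite big_ord0.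
by apply: eq_sqint (sqintD IH (lF n)) => x; rewrite big_ord_recr.
Qed.

Lemma sqintM_bounded (b : R -> R) f (C : R) : measurable_fun [set: R] b ->
  (forall x, `|b x| <= C) -> sqint f -> sqint (fun x => b x * f x).
Proof.
move=> mb bC lf; apply: (@sqint_le _ (fun x => C * f x)); last exact: sqintZ.
  by apply: measurable_funM => //; case: lf.
move=> x; rewrite !normrM ler_wpM2r// (le_trans (bC x))// ler_norm //.
Qed.

Lemma ipC f g : ip f g = ip g f.
Proof. by apply: eq_Rintegral => x _; rewrite mulrC. Qed.

Lemma eq_ip f g f' g' : f =1 f' -> g =1 g' -> ip f g = ip f' g'.
Proof. by move=> /funext -> /funext ->. Qed.

Lemma ipDr f g h : sqint f -> sqint g -> sqint h ->
  ip f (fun x => g x + h x) = ip f g + ip f h.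
Proof.
move=> lf lg lh; rewrite /ip -RintegralD//; try exact: sqintM.
by apply: eq_Rintegral => x _; rewrite mulrDr.
Qed.

Lemma ipZr a f g : sqint f -> sqint g -> ip f (fun x => a * g x) = a * ip f g.
Proof.
move=> lf lg; rewrite /ip -RintegralZl//; last exact: sqintM.
by apply: eq_Rintegral => x _; rewrite mulrCA.
Qed.

Lemma ipBr f g h : sqint f -> sqint g -> sqint h ->
  ip f (fun x => g x - h x) = ip f g - ip f h.
Proof.
move=> lf lg lh; rewrite /ip -RintegralB//; try exact: sqintM.
by apply: eq_Rintegral => x _; rewrite mulrBr.
Qed.

Lemma ipBl f g h : sqint f -> sqint g -> sqint h ->
  ip (fun x => f x - g x) h = ip f h - ip g h.
Proof. by move=> *; rewrite ipC ipBr// (ipC h f) (ipC h g). Qed.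

Lemma ipDl f g h : sqint f -> sqint g -> sqint h ->
  ip (fun x => f x + g x) h = ip f h + ip g h.
Proof. by move=> *; rewrite ipC ipDr// (ipC h f) (ipC h g). Qed.

Lemma ipZl a f g : sqint f -> sqint g -> ip (fun x => a * f x) g = a * ip f g.
Proof. by move=> *; rewrite ipC ipZr// ipC. Qed.

Lemma ip_sumr n f (F : nat -> R -> R) : sqint f -> (forall i, sqint (F i)) ->
  ip f (fun x => \sum_(i < n) F i x) = \sum_(i < n) ip f (F i).
Proof.
move=> lf lF; elim: n => [|n IH].
  rewrite big_ord0 -[RHS](mul0r (ip f f)) -ipZr//; apply: eq_ip => // x.
  by rewrite big_ord0 mul0r.
rewrite big_ord_recr/= -IH -ipDr//; last exact: sqint_sum.
by apply: eq_ip => // x; rewrite big_ord_recr.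
Qed.

Lemma ip_ge0 f : 0 <= ip f f.
Proof. by apply: Rintegral_ge0 => x _; rewrite -expr2 sqr_ge0. Qed.

Lemma ip_cauchy_schwarz f g : sqint f -> sqint g ->
  ip f g ^+ 2 <= ip f f * ip g g.
Proof.
move=> lf lg.
have H a b : 0 <= a ^+ 2 * ip f f - 2 * a * b * ip f g + b ^+ 2 * ip g g.
  have := ip_ge0 (fun x => a * f x - b * g x).
  have la := sqintZ a lf; have lb := sqintZ b lg.
  rewrite ipBl//; last exact: sqintB.
  rewrite !ipBr// !ipZl// !ipZr// (ipC g f); congr (0 <= _); ring.
have f0 := ip_ge0 f; have g0 := ip_ge0 g.
have [E|gn0] := eqVneq (ip g g) 0.
  rewrite E mulr0; have [->|fg0] := eqVneq (ip f g) 0; first by rewrite expr0n.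
  (* With [ip g g = 0] the form is affine in b; this b gives it the value -1. *)
  have := H 1 ((ip f f + 1) / (2 * ip f g)); rewrite E mulr0 addr0.
  rewrite (_ : _ - _ = - 1); first by lra.
  by field.
have gp : 0 < ip g g by rewrite lt_def gn0.
(* Up to scaling, f minus its projection on g. *)
have := H (ip g g) (ip f g).
rewrite (_ : _ + _ = ip g g * (ip f f * ip g g - ip f g ^+ 2)); last by ring.
by rewrite pmulr_rge0// subr_ge0.
Qed.

Lemma Rintegral_fin f : L1 f -> (\int[mu]_x (f x)%:E)%E = (\int[mu]_x f x)%:E.
Proof. by move=> lf; rewrite fineK// integrable_fin_num. Qed.

Lemma ip_fin f : sqint f -> (\int[mu]_x (f x ^+ 2)%:E)%E = (ip f f)%:E.
Proof.
by move=> [mf f2]; rewrite Rintegral_fin//; congr EFin; apply: eq_Rintegral.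
Qed.

Lemma sqint_ip_lty f : measurable_fun [set: R] f ->
  (\int[mu]_x (f x ^+ 2)%:E < +oo)%E -> sqint f.
Proof.
move=> mf oo; split => //; apply/integrableP; split.
  by apply/measurable_EFinP; exact: measurable_funX.
by under eq_integral do rewrite /= ger0_norm ?sqr_ge0//.
Qed.

Lemma ip_eq0_ae f : sqint f -> ip f f = 0 -> {ae mu, forall x, f x = 0}.
Proof.
move=> lf f0.
have mf2 : measurable_fun [set: R] (fun x => (f x ^+ 2)%:E).
  by apply/measurable_EFinP/measurable_funX; case: lf.
have [+ _] := ae_eq_integral_abs mu measurableT mf2.
have -> : (\int[mu]_x `|(f x ^+ 2)%:E| = 0)%E.
  under eq_integral do rewrite /= ger0_norm ?sqr_ge0//.
  by rewrite ip_fin// f0.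
move=> /(_ erefl); apply: filterS => x /(_ I) /= [] /eqP.
by rewrite sqrf_eq0 => /eqP.
Qed.

(** * Finite orthogonal projections and Bessel's inequality *)

Section Orthonormal.
Variable h : nat -> R -> R.
Hypothesis lh : forall i, sqint (h i).
Hypothesis oh : forall i j, ip (h i) (h j) = (i == j)%:R.

Definition projsum n f : R -> R := fun x => \sum_(i < n) ip f (h i) * h i x.

Lemma sqint_projsum n f : sqint (projsum n f).
Proof. by apply: (@sqint_sum n (fun i x => ip f (h i) * h i x)) => i; exact: sqintZ. Qed.

Lemma sqint_residual n f : sqint f -> sqint (fun x => f x - projsum n f x).
Proof. by move=> lf; apply: sqintB => //; exact: sqint_projsum. Qed.

Lemma ip_projsum n f g : sqint g ->
  ip g (projsum n f) = \sum_(i < n) ip f (h i) * ip g (h i).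
Proof.
move=> lg; rewrite (@ip_sumr n g (fun i x => ip f (h i) * h i x))//; last first.
  by move=> i; exact: sqintZ.
by apply: eq_bigr => i _; rewrite ipZr.
Qed.

Lemma ip_residual n f g : sqint f -> sqint g ->
  ip (fun x => f x - projsum n f x) g = ip f g - \sum_(i < n) ip f (h i) * ip g (h i).
Proof.
move=> lf lg; rewrite ipBl//; last exact: sqint_projsum.
by rewrite (ipC (projsum _ _)) ip_projsum.
Qed.

(** An orthogonal projection is self-adjoint. This moves the residual from an arbitrary f onto a
    function whose residual is known to be small. *)
Lemma ip_residualC n f g : sqint f -> sqint g ->
  ip (fun x => f x - projsum n f x) g = ip f (fun x => g x - projsum n g x).
Proof.
move=> lf lg; rewrite [RHS]ipC !ip_residual// (ipC g f).
by congr (_ - _); apply: eq_bigr => i _; rewrite mulrC.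
Qed.

Lemma projsum_proj n f j : (j < n)%N -> ip (projsum n f) (h j) = ip f (h j).
Proof.
move=> jn; rewrite ipC ip_projsum// (bigD1 (Ordinal jn))//= big1 => [|i ij].
  by rewrite oh eqxx mulr1 addr0.
by rewrite oh eq_sym (negbTE (ij : i != _ :> nat)) mulr0.
Qed.

(** The residual is orthogonal to every h_i with i < n, so pairing it with itself is pairing it with
    f. *)
Lemma ip_residual_residual n f : sqint f ->
  ip (fun x => f x - projsum n f x) (fun x => f x - projsum n f x) =
  ip f f - \sum_(i < n) ip f (h i) ^+ 2.
Proof.
move=> lf; rewrite ip_residual//; last exact: (sqint_residual n lf).
rewrite big1 => [|i _]; last first.
  rewrite ipBl//; last exact: sqint_projsum.
  by rewrite projsum_proj// subrr mulr0.
by rewrite subr0 ipC ip_residual.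
Qed.

Lemma bessel n f : sqint f -> \sum_(i < n) ip f (h i) ^+ 2 <= ip f f.
Proof. by move=> lf; rewrite -subr_ge0 -ip_residual_residual// ip_ge0. Qed.

Lemma residual_le n f : sqint f ->
  ip (fun x => f x - projsum n f x) (fun x => f x - projsum n f x) <= ip f f.
Proof.
move=> lf; rewrite ip_residual_residual// lerBlDr lerDl sumr_ge0// => i _.
exact: sqr_ge0.
Qed.

End Orthonormal.
End RealL2.

(** * Gaussian integrals *)

Section GaussianIntegrals.
Context {R : realType}.
Implicit Types f g h : R -> R.
Local Notation mu := (@lebesgue_measure R).

Lemma Rintegral_cvg (F : nat -> R -> R) f g :
  (forall n, measurable_fun [set: R] (F n)) -> measurable_fun [set: R] f ->
  {ae mu, forall x, F ^~ x @ \oo --> f x} -> L1 g ->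
  (forall n x, `|F n x| <= g x) ->
  (\int[mu]_x F n x)%R @[n --> \oo] --> (\int[mu]_x f x)%R.
Proof.
move=> mF mf Ff lg Fg.
have [] := @dominated_convergence _ _ R mu _ measurableT (fun n => EFin \o F n)
    (EFin \o f) (EFin \o g).
- by move=> n; apply/measurable_EFinP; exact: mF.
- exact/measurable_EFinP.
- by apply: aeS Ff => x Fx _; apply: cvg_EFin => //; exact: nearW.
- exact: lg.
- by apply: aeW => x n _ /=; rewrite lee_fin.
move=> lf _; rewrite (Rintegral_fin (f := f))// => /fine_cvg H; exact: H.
Qed.

Lemma ge0_integral_opp (f : R -> \bar R) : measurable_fun [set: R] f ->
  (forall x, 0 <= f x)%E -> (\int[mu]_x f (- x)%R = \int[mu]_x f x)%E.
Proof.
move=> mf f0.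
transitivity (\int[pushforward mu (-%R : _ -> measurableTypeR R)]_x f x)%E.
  by rewrite ge0_integral_pushforward.
by apply: eq_measure_integral => //= A mA _; exact/lebesgue_measureN.
Qed.

Lemma integral_opp (f : R -> \bar R) : measurable_fun [set: R] f ->
  (\int[mu]_x f (- x)%R = \int[mu]_x f x)%E.
Proof.
move=> mf; rewrite integralE [RHS]integralE -(ge0_integral_opp (f := f^\+%E))//.
  rewrite -(ge0_integral_opp (f := f^\-%E))//; last exact: measurable_funeneg.
  by congr (_ - _)%E; apply: eq_integral => x _; rewrite ?funeposE ?funenegE.
by apply: measurable_funepos.
Qed.

Lemma Rintegral_opp f : measurable_fun [set: R] f ->
  \int[mu]_x f (- x) = \int[mu]_x f x.
Proof.
by move=> mf; congr fine; apply: (integral_opp (f := EFin \o f)); exact/measurable_EFinP.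
Qed.

(** Normalised so that [gauss 1] is its own Fourier transform. Negative parameters are allowed:
    [gauss (- a)] is the reciprocal of [gauss a]. *)
Definition gauss (a x : R) : R := expR (- (pi * a * x ^+ 2)).

Lemma gauss_gt0 a x : 0 < gauss a x. Proof. exact: expR_gt0. Qed.

Lemma gauss_ge0 a x : 0 <= gauss a x. Proof. exact: expR_ge0. Qed.

Lemma gauss_le1 a x : 0 <= a -> gauss a x <= 1.
Proof.
by move=> a0; rewrite -expR0 ler_expR oppr_le0 mulr_ge0 ?sqr_ge0// mulr_ge0 ?pi_ge0.
Qed.

Lemma gaussN a x : gauss a (- x) = gauss a x.
Proof. by rewrite /gauss sqrrN. Qed.

Lemma continuous_gauss a : continuous (gauss a).
Proof.
move=> x; apply: (cvg_comp (fun x => - (pi * a * x ^+ 2)) expR); last first.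
  exact: continuous_expR.
apply: (@cvgN _ R^o); apply: cvgM; first exact: cvg_cst.
exact: exprn_continuous.
Qed.

Lemma measurable_gauss a : measurable_fun [set: R] (gauss a).
Proof. by apply: continuous_measurable_fun; exact: continuous_gauss. Qed.

Lemma gauss_shift_integral a m : 0 < a ->
  L1 (fun x => gauss a (x - m)) /\ \int[mu]_x gauss a (x - m) = (Num.sqrt a)^-1.
Proof.
(* The standard deviation for which the normal density of mean m is proportional to
   [gauss a (x - m)]. *)
move=> a0; pose s := (Num.sqrt (2 * pi * a))^-1.
have pa : 0 < 2 * pi * a by rewrite !mulr_gt0// pi_gt0.
have s0 : s != 0 by rewrite invr_neq0// gt_eqF// sqrtr_gt0.
have s2 : s ^+ 2 = (2 * pi * a)^-1 by rewrite exprVn sqr_sqrtr// ltW.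
have pn0 : pi != 0 :> R by rewrite gt_eqF// pi_gt0.
have an0 : a != 0 by rewrite gt_eqF.
have E x : gauss a (x - m) = (Num.sqrt a)^-1 * normal_pdf m s x.
  rewrite normal_pdfE// /normal_peak /normal_fun s2.
  rewrite (_ : (2 * pi * a)^-1 * pi *+ 2 = a^-1); last first.
    move: (pi : R) pn0 => p pn0; rewrite -mulr_natr; field.
    by rewrite an0 pn0.
  rewrite sqrtrV ?ltW// invrK mulrA mulVf ?mul1r; last first.
    by rewrite gt_eqF// sqrtr_gt0.
  congr expR; move: (pi : R) pn0 => p pn0; rewrite -mulr_natr; field.
  by rewrite an0 pn0.
have ln : L1 (normal_pdf m s) by exact: integrable_normal_pdf.
split; first by apply: eq_L1 (L1Z (Num.sqrt a)^-1 ln) => x; rewrite E.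
under eq_Rintegral do rewrite E.
by rewrite RintegralZl// /Rintegral integral_normal_pdf/= mulr1.
Qed.

Lemma L1_gauss a : 0 < a -> L1 (gauss a).
Proof.
by move=> /(gauss_shift_integral 0) [+ _]; apply: eq_L1 => x; rewrite subr0.
Qed.

Lemma integral_gauss a : 0 < a -> \int[mu]_x gauss a x = (Num.sqrt a)^-1.
Proof.
move=> /(gauss_shift_integral 0) [_ <-].
by apply: eq_Rintegral => x _; rewrite subr0.
Qed.

(** Split [gauss a] into two factors [gauss (a / 2)]: one serves the induction hypothesis, the other
    absorbs the additional |x| through exp(y) >= 1 + y. *)
Lemma exprM_gauss_bounded n a : 0 < a ->
  exists C : R, forall x, `|x| ^+ n * gauss a x <= C.
Proof.
elim: n a => [|n IH] a a0.
  by exists 1 => x; rewrite expr0 mul1r gauss_le1// ltW.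
have b0 : 0 < a / 2 by rewrite divr_gt0.
have [C HC] := IH _ b0.
exists (C * (1 + (pi * (a / 2))^-1)) => x.
have -> : gauss a x = gauss (a / 2) x * gauss (a / 2) x.
  by rewrite /gauss -expRD; congr expR; field.
rewrite exprSr [leLHS](_ : _ = (`|x| ^+ n * gauss (a / 2) x) * (`|x| * gauss (a / 2) x)); last by ring.
apply: ler_pM => //.
- by rewrite mulr_ge0 ?exprn_ge0 ?gauss_ge0.
- by rewrite mulr_ge0 ?gauss_ge0.
set b := pi * (a / 2); have b1 : 0 < b by rewrite mulr_gt0 ?pi_gt0.
rewrite /gauss -/b expRN ler_pdivrMr ?expR_gt0//.
apply: (@le_trans _ _ ((1 + b^-1) * (1 + b * x ^+ 2))); last first.
  by apply: ler_wpM2l (expR_ge1Dx _); rewrite addr_ge0// invr_ge0 ltW.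
have -> : (1 + b^-1) * (1 + b * x ^+ 2) = (1 + x ^+ 2) + (b^-1 + b * x ^+ 2).
  by field; rewrite gt_eqF.
have : 0 <= b^-1 + b * x ^+ 2.
  by rewrite addr_ge0 ?invr_ge0 ?(ltW b1)// mulr_ge0 ?sqr_ge0// ltW.
rewrite -(real_normK (num_real x)); have := normr_ge0 x; nra.
Qed.

End GaussianIntegrals.

(** * Functions of Gaussian decay and integration by parts *)

Section GaussianDecay.
Context {R : realType}.
Implicit Types f g h : R -> R.
Local Notation mu := (@lebesgue_measure R).

Lemma is_deriveM_fun f g (x a b : R) : is_derive x 1 f a -> is_derive x 1 g b ->
  is_derive x 1 (fun t => f t * g t) (f x * b + a * g x).
Proof. by move=> df dg; apply: is_derive_eq (is_deriveM df dg) _; rewrite (mulrC a). Qed.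

Lemma is_deriveD_fun f g (x a b : R) : is_derive x 1 f a -> is_derive x 1 g b ->
  is_derive x 1 (fun t => f t + g t) (a + b).
Proof. by move=> df dg; exact: is_deriveD df dg. Qed.

Lemma is_deriveZ_fun f (c x a : R) : is_derive x 1 f a ->
  is_derive x 1 (fun t => c * f t) (c * a).
Proof. by move=> df; exact: (is_deriveZ c df). Qed.

Lemma is_derive_expR_comp f (x a : R) : is_derive x 1 f a ->
  is_derive x 1 (fun t => expR (f t)) (expR (f x) * a).
Proof.
move=> df; apply: is_derive_eq (is_derive1_comp (is_derive_expR (f x)) df) _.
by rewrite mulrC.
Qed.

Lemma is_derive_gauss (a x : R) :
  is_derive x 1 (gauss a) (- (2 * pi * a * x) * gauss a x).
Proof.
have di : is_derive x (1 : R) (fun t : R => t) 1 by exact: is_derive_id.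
have dq : is_derive x 1 (fun t : R => (- (pi * a)) * (t * t)) (- (2 * pi * a * x)).
  apply: is_derive_eq (is_deriveZ_fun _ (is_deriveM_fun di di)) _.
  ring.
have := is_derive_expR_comp dq.
rewrite (_ : (fun t => _) = gauss a); last first.
  by apply/funext => t; rewrite /gauss; congr expR; ring.
move=> H; apply: is_derive_eq H _; rewrite mulrC; congr (_ * _).
by rewrite /gauss; congr expR; ring.
Qed.

(** A class stable under sums, products, multiplication by x and by bounded continuous functions.
    Its members are integrable and have no boundary terms in integrations by parts, and it contains
    the Hermite functions. *)
Definition gdecay f : Prop := continuous f /\
  exists C, exists2 a, 0 < a & forall x, `|f x| <= C * gauss a x.

Lemma gdecay_measurable f : gdecay f -> measurable_fun [set: R] f.
Proof. by move=> [cf _]; exact: continuous_measurable_fun. Qed.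

Lemma gdecay_L1 f : gdecay f -> L1 f.
Proof.
move=> lf; have [cf [C [a a0 H]]] := lf.
apply: L1_le H _; first exact: gdecay_measurable.
exact/L1Z/L1_gauss.
Qed.

Lemma gdecay_C f : gdecay f ->
  exists2 C, 0 <= C & exists2 a, 0 < a & forall x, `|f x| <= C * gauss a x.
Proof.
move=> [cf [C [a a0 H]]]; exists C; last by exists a.
by have := H 0; rewrite /gauss expr0n/= mulr0 oppr0 expR0 mulr1; apply: le_trans.
Qed.

Lemma gdecay_bounded f : gdecay f -> exists C, forall x, `|f x| <= C.
Proof.
move=> /gdecay_C[C C0 [a a0 H]]; exists C => x; rewrite (le_trans (H x))//.
by rewrite ler_piMr// gauss_le1// ltW.
Qed.

Lemma gdecayM_bounded (b : R -> R) (B : R) f : continuous b ->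
  (forall x, `|b x| <= B) -> gdecay f -> gdecay (fun x => b x * f x).
Proof.
move=> cb bB lf; have [cf _] := lf; have [C C0 [a a0 H]] := gdecay_C lf.
split; first by move=> x; apply: continuousM; [exact: cb|exact: cf].
exists (B * C); exists a => // x; rewrite normrM -mulrA ler_pM//.
Qed.

Lemma gdecayM f g : gdecay f -> gdecay g -> gdecay (fun x => f x * g x).
Proof.
move=> lf; have [cf _] := lf; have [B HB] := gdecay_bounded lf.
exact: gdecayM_bounded HB.
Qed.

Lemma gdecayZ c f : gdecay f -> gdecay (fun x => c * f x).
Proof.
by apply: (@gdecayM_bounded (fun=> c) `|c|) => // x; exact: cst_continuous.
Qed.

Lemma gdecayD f g : gdecay f -> gdecay g -> gdecay (fun x => f x + g x).
Proof.
move=> lf lg; have [cf _] := lf; have [cg _] := lg.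
have [C C0 [a a0 H]] := gdecay_C lf; have [D D0 [b b0 K]] := gdecay_C lg.
split; first by move=> x; apply: continuousD; [exact: cf|exact: cg].
exists (C + D); exists (Order.min a b) => [|x]; first by rewrite lt_min a0.
rewrite (le_trans (ler_normD _ _))// mulrDl lerD//.
  rewrite (le_trans (H x))// ler_wpM2l// ler_expR lerN2.
  by rewrite ler_wpM2r ?sqr_ge0// ler_wpM2l ?pi_ge0// ge_min lexx.
rewrite (le_trans (K x))// ler_wpM2l// ler_expR lerN2.
by rewrite ler_wpM2r ?sqr_ge0// ler_wpM2l ?pi_ge0// ge_min lexx orbT.
Qed.

Lemma gdecay_gauss a : 0 < a -> gdecay (@gauss R a).
Proof.
move=> a0; split; first exact: continuous_gauss.
by exists 1; exists a => // x; rewrite mul1r ger0_norm// gauss_ge0.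
Qed.

Lemma gdecayXM f : gdecay f -> gdecay (fun x => x * f x).
Proof.
move=> lf; have [cf _] := lf; have [C C0 [a a0 H]] := gdecay_C lf.
have b0 : 0 < a / 2 by rewrite divr_gt0.
have [D HD] := exprM_gauss_bounded 1 b0.
split; first by move=> x; apply: continuousM; [exact: cvg_id|exact: cf].
exists (C * D); exists (a / 2) => // x; rewrite normrM.
rewrite (le_trans (ler_wpM2l (normr_ge0 x) (H x)))//.
rewrite mulrCA -mulrA ler_wpM2l//.
have -> : gauss a x = gauss (a / 2) x * gauss (a / 2) x.
  by rewrite /gauss -expRD; congr expR; field.
by rewrite mulrA ler_wpM2r ?gauss_ge0//; have := HD x; rewrite expr1.
Qed.

Lemma gdecay_sqint f : gdecay f -> sqint f.
Proof.
move=> lf; split; first exact: gdecay_measurable.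
by apply: eq_L1 (gdecay_L1 (gdecayM lf lf)) => x; rewrite expr2.
Qed.

(** Since x f(x) is bounded, f decays like 1 / (n + 1) along u. The sign of u is left free so that
    both boundary terms of an integration over [-(n+1), n+1] are covered. *)
Lemma gdecay_cvg0 f (u : nat -> R) : gdecay f -> (forall n, `|u n| = n.+1%:R) ->
  (fun n => f (u n)) @ \oo --> 0.
Proof.
move=> lf hu; have [C HC] := gdecay_bounded (gdecayXM lf).
have Cn : (fun n => C * n.+1%:R^-1) @ \oo --> (0 : R).
  by rewrite -[X in _ --> X](mulr0 C); apply: cvgM; [exact: cvg_cst|exact: cvg_harmonic].
apply: (@squeeze_cvgr _ _ _ _ (fun n => - (C * n.+1%:R^-1)) (fun n => C * n.+1%:R^-1)).
- apply: nearW => n; rewrite -ler_norml ler_pdivlMr//.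
  by rewrite mulrC -hu -normrM.
- by rewrite -[X in _ --> X]oppr0; exact: cvgN.
- exact: Cn.
Qed.

(** Exhaust the line by the intervals [-(n+1), n+1]: the fundamental theorem leaves two boundary
    values of F, which tend to 0, while dominated convergence recovers the full integral. *)
Lemma Rintegral_derive_eq0 (F f : R -> R) :
  (forall x : R, is_derive x 1 F (f x)) -> gdecay F -> gdecay f ->
  \int[mu]_x f x = 0.
Proof.
move=> dF gF gf.
pose I n : set R := `[- n.+1%:R, n.+1%:R]%classic.
have H1 : (\int[mu]_x (\1_(I n) x * f x))%R @[n --> \oo] --> (\int[mu]_x f x)%R.
  apply: (@Rintegral_cvg _ _ _ (fun x => `|f x|)).
  - by move=> n; apply: measurable_funM; [apply: measurable_indic; exact: measurable_itv|exact: gdecay_measurable].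
  - exact: gdecay_measurable.
  - apply: aeW => x; apply: cvg_near_cst.
    near=> n; suff xI : I n x by rewrite indicE mem_set// mul1r.
    rewrite /I/= in_itv/= -ler_norml (@le_trans _ _ n%:R)// ?ler_nat//.
    by near: n; exact: nbhs_infty_ger.
  - exact/L1_norm/gdecay_L1.
  - move=> n x; rewrite normrM ler_piMl// indicE; case: (x \in I n); rewrite ?normr1 ?normr0//.
have E n : \int[mu]_x (\1_(I n) x * f x) = F n.+1%:R - F (- n.+1%:R).
  transitivity (\int[mu]_(x in I n) f x).
    rewrite [RHS]Rintegral_mkcond; apply: eq_Rintegral => x _.
    by rewrite patchE indicE; case: ifPn => xI; rewrite ?mul1r ?mul0r.
  rewrite /Rintegral (@continuous_FTC2 _ f F)//.
  - by rewrite (@lt_trans _ _ 0)// ?oppr_lt0 ltr0n.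
  - apply: continuous_subspaceT; exact: (proj1 gf).
  - split=> [x _||]; first by have [] := dF x.
      by apply: cvg_at_right_filter; exact: (proj1 gF).
    by apply: cvg_at_left_filter; exact: (proj1 gF).
  - by move=> x _; rewrite derive1E; have [] := dF x.
have H2 : (fun n => \int[mu]_x (\1_(I n) x * f x)) @ \oo --> 0.
  under eq_fun do rewrite E; rewrite -(subr0 0); apply: cvgB.
    by apply: gdecay_cvg0 => // n; rewrite ger0_norm.
  by apply: gdecay_cvg0 => // n; rewrite normrN ger0_norm.
exact: (cvg_unique _ H1 H2).
Unshelve. all: by end_near. Qed.

Lemma Rintegral_by_parts f f' g g' :
  (forall x : R, is_derive x 1 f (f' x)) -> (forall x : R, is_derive x 1 g (g' x)) ->
  gdecay (fun x => f x * g x) -> gdecay (fun x => f x * g' x) ->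
  gdecay (fun x => f' x * g x) ->
  \int[mu]_x (f' x * g x) = - \int[mu]_x (f x * g' x).
Proof.
move=> df dg fg fg' f'g; apply/eqP; rewrite -addr_eq0 addrC -RintegralD//;
  try exact: gdecay_L1.
apply/eqP; apply: (Rintegral_derive_eq0 _ fg (gdecayD fg' f'g)) => x.
exact: is_deriveM_fun.
Qed.

End GaussianDecay.

(** * The Hartley kernel *)

Section Hartley.
Context {R : realType}.
Implicit Types f g h : R -> R.
Local Notation mu := (@lebesgue_measure R).

Definition cas (x : R) : R := cos x + sin x.

Lemma cos_normr_le1 (x : R) : `|cos x| <= 1.
Proof. by rewrite ler_norml cos_geN1 cos_le1. Qed.

Lemma sin_normr_le1 (x : R) : `|sin x| <= 1.
Proof. by rewrite ler_norml sin_geN1 sin_le1. Qed.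

Lemma cas_normr_le2 (x : R) : `|cas x| <= 2.
Proof.
rewrite (le_trans (ler_normD _ _))// (_ : 2 = 1 + 1)//.
by rewrite lerD ?cos_normr_le1 ?sin_normr_le1.
Qed.

Lemma continuous_linear_comp f (c : R) : continuous f -> continuous (fun x => f (c * x)).
Proof.
move=> cf x; apply: (cvg_comp (fun x => c * x) f); last exact: cf.
by apply: cvgM; [exact: cvg_cst|exact: cvg_id].
Qed.

Lemma continuous_cas : continuous cas.
Proof.
by move=> x; apply: continuousD; [exact: continuous_cos|exact: continuous_sin].
Qed.

Lemma is_derive_linear_comp f (f' c x : R) : is_derive (c * x) 1 f f' ->
  is_derive x 1 (fun t => f (c * t)) (c * f').
Proof.
move=> df; have di : is_derive x (1 : R) (fun t : R => t) 1 by exact: is_derive_id.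
have dl := is_deriveZ_fun c di.
apply: is_derive_eq (is_derive1_comp df dl) _.
ring.
Qed.

(** Differentiating the kernel reverses its argument; this is the source of every [- xi] in the
    recurrences below. *)
Lemma is_derive_cas (c x : R) :
  is_derive x 1 (fun t => cas (c * t)) (c * cas (- (c * x))).
Proof.
apply: is_derive_linear_comp.
apply: is_derive_eq (is_deriveD_fun (is_derive_cos _) (is_derive_sin _)) _.
by rewrite /cas cosN sinN addrC.
Qed.

(** Against an even weight the sine term integrates to 0, so Gaussian pairings of two kernels depend
    on the difference of their frequencies alone. *)
Lemma cas_mul (x y : R) : cas x * cas y = cos (x - y) + sin (x + y).
Proof. rewrite cosB sinD /cas; ring. Qed.

(** * Cosine and sine transforms of the Gaussian *)

Section CosTransform.
Variable a : R.
Hypothesis a0 : 0 < a.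

Let c (x : R) : R := \int[mu]_t (gauss a t * cos (2 * pi * t * x)).

Let gc x : gdecay (fun t : R => gauss a t * cos (2 * pi * t * x)).
Proof.
have H := @gdecayM_bounded R (fun t => cos ((2 * pi * x) * t)) 1 (gauss a) _ _ (gdecay_gauss a0).
rewrite (_ : (fun t => _) = (fun t => cos ((2 * pi * x) * t) * gauss a t)).
  apply: H => [|t]; last exact: cos_normr_le1.
  by apply: continuous_linear_comp; exact: continuous_cos.
by apply/funext => t; rewrite mulrC; congr (cos _ * _); ring.
Qed.

Let gs x : gdecay (fun t : R => gauss a t * sin (2 * pi * t * x)).
Proof.
have H := @gdecayM_bounded R (fun t => sin ((2 * pi * x) * t)) 1 (gauss a) _ _ (gdecay_gauss a0).
rewrite (_ : (fun t => _) = (fun t => sin ((2 * pi * x) * t) * gauss a t)).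
  apply: H => [|t]; last exact: sin_normr_le1.
  by apply: continuous_linear_comp; exact: continuous_sin.
by apply/funext => t; rewrite mulrC; congr (sin _ * _); ring.
Qed.

Let dcos (t x : R) : is_derive x 1 (fun x => gauss a t * cos (2 * pi * t * x))
  (- (2 * pi) * (t * (gauss a t * sin (2 * pi * t * x)))).
Proof.
apply: is_derive_eq (is_deriveZ_fun _ (is_derive_linear_comp (is_derive_cos _))) _.
ring.
Qed.

(** The linear differential equation satisfied by the Gaussian of parameter 1 / a: differentiation
    under the integral brings out the sine integral with a factor t, and integration by parts turns
    it back into c. *)
Let dc (x : R) : is_derive x 1 c (- (2 * pi * a^-1 * x) * c x).
Proof.
pose f (x t : R) := gauss a t * cos (2 * pi * t * x).
have d1 y t : partial1of2 f y t = - (2 * pi) * (t * (gauss a t * sin (2 * pi * t * y))).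
  by rewrite partial1of2E; have [_ <-] := dcos t y.
have gG : L1 (fun t : R => 2 * pi * `|t * gauss a t|).
  by apply/L1Z/L1_norm/gdecay_L1/gdecayXM; exact: gdecay_gauss.
have G0 (t : R) : 0 <= 2 * pi * `|t * gauss a t|.
  by rewrite mulr_ge0// mulr_ge0// pi_ge0.
have xI : [set` `]x - 1, x + 1[] x.
  by rewrite /= in_itv/= ltrBlDr ltrDl ltr01.
have If y : [set` `]x - 1, x + 1[] y -> mu.-integrable setT (EFin \o f y).
  by move=> _; exact: gdecay_L1 (gc y).
have Df y t : [set` `]x - 1, x + 1[] y -> setT t -> derivable (f ^~ t) y 1.
  by move=> _ _; have [] := dcos t y.
have Gf y t : [set` `]x - 1, x + 1[] y -> setT t ->
    `|partial1of2 f y t| <= 2 * pi * `|t * gauss a t|.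
  move=> _ _; rewrite d1 normrM normrN (ger0_norm (_ : 0 <= 2 * pi)); last first.
    by rewrite mulr_ge0// pi_ge0.
  rewrite ler_wpM2l ?mulr_ge0 ?pi_ge0// mulrA normrM ler_piMr//.
  exact: sin_normr_le1.
have D1 := @derivable_under_integral R _ _ mu f setT measurableT x (x - 1) (x + 1)
  xI If Df _ G0 gG Gf.
have D2 := @differentiation_under_integral R _ _ mu f setT measurableT x (x - 1) (x + 1)
  xI If Df _ G0 gG Gf.
apply: DeriveDef; first exact: D1.
rewrite -derive1E [LHS]D2.
under eq_Rintegral do rewrite d1.
rewrite RintegralZl//; last exact: gdecay_L1 (gdecayXM (gs x)).
(* The integrand is the derivative in t of [gauss a t * sin (2 * pi * t * x)]. *)
have H : \int[mu]_t (- (2 * pi * a) * (t * (gauss a t * sin (2 * pi * t * x)))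
    + 2 * pi * x * (gauss a t * cos (2 * pi * t * x))) = 0.
  apply: (Rintegral_derive_eq0 _ (gs x)) => [t|]; last first.
    by apply: gdecayD; apply: gdecayZ; [exact: gdecayXM (gs x)|exact: gc].
  have ds := is_derive_linear_comp (is_derive_sin (2 * pi * x * t)).
  have := is_deriveM_fun (is_derive_gauss a t) ds.
  rewrite (_ : (fun t0 => _) = (fun t => gauss a t * sin (2 * pi * t * x))); last first.
    by apply/funext => s; congr (_ * sin _); ring.
  move=> E; apply: is_derive_eq E _.
  rewrite (_ : 2 * pi * x * t = 2 * pi * t * x); last by ring.
  ring.
move: H; rewrite RintegralD//; last 2 first.
  - exact: gdecay_L1 (gdecayZ _ (gdecayXM (gs x))).
  - exact: gdecay_L1 (gdecayZ _ (gc x)).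
rewrite RintegralZl//; last exact: gdecay_L1 (gc x).
rewrite RintegralZl//; last exact: gdecay_L1 (gdecayXM (gs x)).
rewrite -/(c x); set S := (\int[mu]_x0 _) => H.
have aS : a * S = x * c x.
  have p0 : pi != 0 :> R by rewrite gt_eqF// pi_gt0.
  apply: (mulfI (_ : 2 * pi != 0 :> R)); first by rewrite mulf_neq0.
  by apply/eqP; rewrite -subr_eq0 -oppr_eq0 -[X in _ == X]H; apply/eqP; ring.
have -> : S = a^-1 * (x * c x) by rewrite -aS mulKf// gt_eqF.
ring.
Qed.

Lemma cos_transform_gauss x :
  \int[mu]_t (gauss a t * cos (2 * pi * t * x)) = (Num.sqrt a)^-1 * gauss a^-1 x.
Proof.
(* The quotient of c by the expected solution; its derivative vanishes, and its value at 0 is the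
   Gaussian integral. *)
pose F x := c x * gauss (- a^-1) x.
have dF (y : R) : is_derive y 1 F 0.
  apply: is_derive_eq (is_deriveM_fun (dc y) (is_derive_gauss (- a^-1) y)) _.
  ring.
have := is_derive_0_is_cst x 0 dF.
have -> : F 0 = (Num.sqrt a)^-1.
  rewrite /F /c (_ : gauss (- a^-1) 0 = 1) ?mulr1; last first.
    by rewrite /gauss expr0n/= mulr0 oppr0 expR0.
  under eq_Rintegral do rewrite mulr0 cos0 mulr1.
  exact: integral_gauss.
move=> <-; rewrite /F -mulrA -expRD.
by rewrite (_ : _ + _ = 0) ?expR0 ?mulr1//; ring.
Qed.

Lemma sin_transform_gauss x : \int[mu]_t (gauss a t * sin (2 * pi * t * x)) = 0.
Proof.
have mf := gdecay_measurable (gs x).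
have := Rintegral_opp mf.
under eq_Rintegral do rewrite gaussN mulrN mulNr sinN mulrN -mulN1r.
rewrite RintegralZl//; last exact: gdecay_L1 (gs x).
by move=> /eqP; rewrite mulN1r eq_sym -subr_eq0 opprK -mulr2n mulrn_eq0 => /eqP.
Qed.

Lemma L1_gauss_cos x : L1 (fun t : R => gauss a t * cos (2 * pi * t * x)).
Proof. exact: gdecay_L1. Qed.

Lemma L1_gauss_sin x : L1 (fun t : R => gauss a t * sin (2 * pi * t * x)).
Proof. exact: gdecay_L1. Qed.

End CosTransform.

Lemma cas_transform_gauss a x y : 0 < a ->
  \int[mu]_t (gauss a t * cas (2 * pi * t * x) * cas (2 * pi * t * y)) =
  (Num.sqrt a)^-1 * gauss a^-1 (x - y).
Proof.
move=> a0; rewrite -cos_transform_gauss// -[RHS]addr0.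
rewrite -[X in _ = _ + X](sin_transform_gauss a0 (x + y)) -RintegralD//; last 2 first.
  - exact: L1_gauss_cos.
  - exact: L1_gauss_sin.
apply: eq_Rintegral => t _; rewrite -mulrA cas_mul mulrDr.
by rewrite [2 * pi * t * (x - y)]mulrBr [2 * pi * t * (x + y)]mulrDr.
Qed.

End Hartley.

(** * The Hartley transform and the heat semigroup *)

Section HartleyTransform.
Context {R : realType}.
Implicit Types f g h u v w : R -> R.
Local Notation mu := (@lebesgue_measure R).

Lemma Fubini_bounded_kernel u w (k : R * R -> R) (B : R) : L1 u -> L1 w ->
  measurable_fun setT k -> (forall z, `|k z| <= B) ->
  \int[mu]_x (u x * \int[mu]_y (w y * k (x, y))) =
  \int[mu]_y (w y * \int[mu]_x (u x * k (x, y))).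
Proof.
move=> lu lw mk kB.
have mu1 : measurable_fun [set: R] u by exact: L1_measurable.
have mw1 : measurable_fun [set: R] w by exact: L1_measurable.
have lwk x : L1 (fun y => w y * k (x, y)).
  apply: (@eq_L1 _ (fun y => k (x, y) * w y)) => [y|]; first by rewrite mulrC.
  apply: L1M_bounded (fun y => kB (x, y)) lw.
  exact: (measurableT_comp mk (measurable_pair1 x)).
have luk y : L1 (fun x => u x * k (x, y)).
  apply: (@eq_L1 _ (fun x => k (x, y) * u x)) => [x|]; first by rewrite mulrC.
  apply: L1M_bounded (fun x => kB (x, y)) lu.
  exact: (measurableT_comp mk (measurable_pair2 y)).
pose f (z : R * R) : \bar R := (u z.1 * w z.2 * k z)%:E.
have mf : measurable_fun setT f.
  apply/measurable_EFinP; apply: measurable_funM => //.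
  by apply: measurable_funM; [exact: measurableT_comp mu1 measurable_fst|
    exact: measurableT_comp mw1 measurable_snd].
have fi : ((mu \x mu)%E).-integrable setT f.
  apply/(@integrable12ltyP _ _ _ _ R mu mu f mf).
  apply: (@le_lt_trans _ _ (\int[mu]_x (`|u x| * (B * \int[mu]_y `|w y|))%:E)%E).
    apply: ge0_le_integral => //.
    - by move=> x _; apply: integral_ge0.
    - apply: (@measurable_fun_fubini_tonelli_F _ _ _ _ R mu (abse \o f)) => //=.
      exact: measurableT_comp.
    - apply/measurable_EFinP; apply: measurable_funM => //.
      by apply: measurableT_comp.
    - move=> x _.
      apply: (@le_trans _ _ (\int[mu]_y (`|u x| * B * `|w y|)%:E)%E).
        apply: ge0_le_integral => //.
        + apply: measurableT_comp => //.
          exact: (measurableT_comp mf (measurable_pair1 x)).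
        + apply/measurable_EFinP; apply: measurable_funM => //.
          by apply: measurableT_comp.
        + move=> y _; rewrite /f /= lee_fin !normrM -mulrA -[leRHS]mulrA ler_wpM2l//.
          by rewrite mulrC ler_wpM2r.
      rewrite Rintegral_fin; last exact/L1Z/L1_norm.
      by rewrite RintegralZl ?mulrA//; exact: L1_norm.
  rewrite Rintegral_fin ?ltry//.
  apply: (@eq_L1 _ (fun x => (B * \int[mu]_y `|w y|) * `|u x|)) => [x|].
    by rewrite mulrC.
  exact/L1Z/L1_norm.
have E1 x : (\int[mu]_y f (x, y) = (u x * \int[mu]_y (w y * k (x, y)))%:E)%E.
  rewrite /f /=; under eq_integral do rewrite -mulrA.
  by rewrite (Rintegral_fin (L1Z (u x) (lwk x))) RintegralZl//; exact: lwk.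
have E2 y : (\int[mu]_x f (x, y) = (w y * \int[mu]_x (u x * k (x, y)))%:E)%E.
  rewrite /f /=; under eq_integral do rewrite (mulrC (u _)) -mulrA.
  by rewrite (Rintegral_fin (L1Z (w y) (luk y))) RintegralZl//; exact: luk.
rewrite /Rintegral; congr fine.
under eq_integral do rewrite -E1; under [RHS]eq_integral do rewrite -E2.
exact: Fubini.
Qed.

Definition hartley u (xi : R) : R := \int[mu]_t (u t * cas (2 * pi * t * xi)).

Lemma measurable_cas_lin (xi : R) :
  measurable_fun [set: R] (fun t => cas (2 * pi * t * xi)).
Proof.
apply: (measurableT_comp (continuous_measurable_fun continuous_cas)).
by apply: measurable_funM => //; exact: measurable_funM.
Qed.

Lemma L1_cas u (xi : R) : L1 u -> L1 (fun t => u t * cas (2 * pi * t * xi)).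
Proof.
move=> lu; apply: (@eq_L1 _ (fun t => cas (2 * pi * t * xi) * u t)) => [t|].
  by rewrite mulrC.
exact: (L1M_bounded (measurable_cas_lin xi) (fun t => cas_normr_le2 _) lu).
Qed.

Lemma hartley_bounded u xi : L1 u -> `|hartley u xi| <= 2 * \int[mu]_t `|u t|.
Proof.
move=> lu; apply: (le_trans (le_normr_Rintegral _ (L1_cas xi lu))) => //.
rewrite -RintegralZl//; last exact: L1_norm.
apply: le_Rintegral => //; first exact/L1_norm/L1_cas.
  exact/L1Z/L1_norm.
by move=> t _; rewrite normrM mulrC ler_wpM2r// cas_normr_le2.
Qed.

Lemma continuous_hartley u : L1 u -> continuous (hartley u).
Proof.
move=> lu x.
have H := @continuity_under_integral R _ _ mu
  (fun xi t => u t * cas (2 * pi * t * xi)) setT measurableT (x - 1) (x + 1).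
have gG : L1 (fun t => 2 * `|u t|) by exact/L1Z/L1_norm.
apply: (H _ _ _ gG) => //.
- by move=> y _; exact: L1_cas.
- apply: aeW => t _ y _; apply: cvgM; first exact: cvg_cst.
  exact: (@continuous_linear_comp _ cas (2 * pi * t) continuous_cas y).
- move=> y _; apply: aeW => t _.
  by rewrite normrM mulrC ler_wpM2r// cas_normr_le2.
- by rewrite inE/= in_itv/= ltrBlDr ltrDl ltr01.
Qed.

Lemma measurable_hartley u : L1 u -> measurable_fun [set: R] (hartley u).
Proof. by move=> lu; apply: continuous_measurable_fun; exact: continuous_hartley. Qed.

Lemma hartleyB u v xi : L1 u -> L1 v ->
  hartley (fun t => u t - v t) xi = hartley u xi - hartley v xi.
Proof.
move=> lu lv; rewrite /hartley -RintegralB//; try exact: L1_cas.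
by apply: eq_Rintegral => t _; rewrite mulrBl.
Qed.

Lemma measurable_cas_prod :
  measurable_fun setT (fun z : R * R => cas (2 * pi * z.1 * z.2)).
Proof.
apply: (measurableT_comp (continuous_measurable_fun continuous_cas)).
apply: measurable_funM => //; apply: measurable_funM => //.
Qed.

Lemma hartley_selfadjoint u w : L1 u -> L1 w ->
  \int[mu]_xi (hartley u xi * w xi) = \int[mu]_t (u t * hartley w t).
Proof.
move=> lu lw.
have := @Fubini_bounded_kernel u w _ 2 lu lw measurable_cas_prod
  (fun z => cas_normr_le2 _).
rewrite /hartley => /= E; under eq_Rintegral do rewrite mulrC.
rewrite -E; apply: eq_Rintegral => t _; congr (_ * _).
by apply: eq_Rintegral => s _; congr (_ * cas _); ring.
Qed.

(** The heat kernel at time 1 / (4 pi b): a probability density that concentrates at 0 as b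
    grows. *)
Definition heat_kernel (b z : R) : R := Num.sqrt b * gauss b z.

Definition heat (b : R) u (x : R) : R := \int[mu]_t (u t * heat_kernel b (x - t)).

Lemma heat_kernel_ge0 b z : 0 <= heat_kernel b z.
Proof. by rewrite mulr_ge0// gauss_ge0. Qed.

Lemma heat_kernel_le b z : 0 <= b -> heat_kernel b z <= Num.sqrt b.
Proof. by move=> b0; rewrite ler_piMr// gauss_le1. Qed.

Lemma heat_kernelN b z : heat_kernel b (- z) = heat_kernel b z.
Proof. by rewrite /heat_kernel gaussN. Qed.

Lemma heat_kernel_integral b m : 0 < b ->
  L1 (fun x => heat_kernel b (x - m)) /\ \int[mu]_x heat_kernel b (x - m) = 1.
Proof.
move=> b0; have [lg ig] := gauss_shift_integral m b0.
split; first exact: L1Z.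
by rewrite RintegralZl// ig mulfV// gt_eqF// sqrtr_gt0.
Qed.

Lemma measurable_heat_kernel b : measurable_fun [set: R] (heat_kernel b).
Proof. by apply: measurable_funM => //; exact: measurable_gauss. Qed.

Lemma measurable_heat_kernel_prod b :
  measurable_fun setT (fun z : R * R => heat_kernel b (z.1 - z.2)).
Proof.
apply: (measurableT_comp (measurable_heat_kernel b)).
exact: measurable_funB.
Qed.

Lemma L1_heat_kernel b u x : 0 < b -> L1 u ->
  L1 (fun t => u t * heat_kernel b (x - t)).
Proof.
move=> b0 lu; apply: (@eq_L1 _ (fun t => heat_kernel b (x - t) * u t)) => [t|].
  by rewrite mulrC.
apply: (L1M_bounded (C := Num.sqrt b)) lu.
  by apply: (measurableT_comp (measurable_heat_kernel b)); exact: measurable_funB.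
by move=> t; rewrite ger0_norm ?heat_kernel_ge0// heat_kernel_le// ltW.
Qed.

(** Tonelli's theorem and the unit mass of the kernel. It is applied to the square of a function. *)
Lemma heat_mass b w : 0 < b -> L1 w -> (forall x, 0 <= w x) ->
  L1 (heat b w) /\ \int[mu]_x heat b w x = \int[mu]_x w x.
Proof.
move=> b0 lw w0.
have mw := L1_measurable lw.
pose f (z : R * R) : \bar R := (w z.2 * heat_kernel b (z.1 - z.2))%:E.
have mf : measurable_fun setT f.
  apply/measurable_EFinP; apply: measurable_funM.
    exact: measurableT_comp mw measurable_snd.
  exact: measurable_heat_kernel_prod.
have f0 z : (0 <= f z)%E by rewrite lee_fin mulr_ge0// heat_kernel_ge0.
have E1 x : (\int[mu]_y f (x, y) = (heat b w x)%:E)%E.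
  by rewrite Rintegral_fin//; exact: L1_heat_kernel.
have E2 y : (\int[mu]_x f (x, y) = (w y)%:E)%E.
  have [lk ik] := heat_kernel_integral y b0.
  by rewrite /f/= (Rintegral_fin (L1Z (w y) lk)) RintegralZl// ik mulr1.
have mh : measurable_fun [set: R] (heat b w).
  apply/measurable_EFinP.
  rewrite (_ : EFin \o _ = fun x => \int[mu]_y f (x, y))%E; last first.
    by apply/funext => x; rewrite E1.
  exact: (@measurable_fun_fubini_tonelli_F _ _ _ _ R mu f).
have h0 x : 0 <= heat b w x by apply: Rintegral_ge0 => t _; rewrite mulr_ge0// heat_kernel_ge0.
have := @fubini_tonelli _ _ _ _ R mu mu f mf f0.
under eq_integral do rewrite E1; under [X in _ = X]eq_integral do rewrite E2.
move=> E; split; last by rewrite /Rintegral E.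
apply/integrableP; split; first exact/measurable_EFinP.
under eq_integral do rewrite /= ger0_norm//.
by rewrite E Rintegral_fin// ltry.
Qed.

(** A regularised inversion formula: self-adjointness moves the outer transform onto a Gaussian
    times cas, whose transform is the heat kernel. *)
Lemma hartley_gauss_hartley a u x : 0 < a -> L1 u ->
  hartley (fun xi => hartley u xi * gauss a xi) x = heat a^-1 u x.
Proof.
move=> a0 lu.
pose w xi := gauss a xi * cas (2 * pi * xi * x).
have lw : L1 w by exact/L1_cas/L1_gauss.
transitivity (\int[mu]_xi (hartley u xi * w xi)).
  by apply: eq_Rintegral => t _; rewrite mulrA.
rewrite hartley_selfadjoint//; apply: eq_Rintegral => t _; congr (_ * _).
by rewrite /hartley /w cas_transform_gauss// /heat_kernel sqrtrV// ltW.
Qed.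

Lemma L1_hartley_gauss a u : 0 < a -> L1 u -> L1 (fun xi => hartley u xi * gauss a xi).
Proof.
move=> a0 lu; apply: (L1M_bounded (measurable_hartley lu)) (L1_gauss a0) => xi.
exact: hartley_bounded.
Qed.

(** By self-adjointness the integral is that of u times its heat regularisation. Bounding u(x) u(t)
    by half the sum of the squares, under a kernel of mass 1 in either variable, gives the norm of
    u. *)
Lemma hartley_sqr_gauss a u : 0 < a -> L1 u -> sqint u ->
  L1 (fun xi => hartley u xi ^+ 2 * gauss a xi) /\
  \int[mu]_xi (hartley u xi ^+ 2 * gauss a xi) <= ip u u.
Proof.
move=> a0 lu l2u; have b0 : 0 < a^-1 by rewrite invr_gt0.
have lw := L1_hartley_gauss a0 lu.
have E xi : hartley u xi ^+ 2 * gauss a xi = hartley u xi * (hartley u xi * gauss a xi).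
  by rewrite expr2 mulrA.
split.
  apply: (eq_L1 (fun xi => esym (E xi))).
  by apply: (L1M_bounded (measurable_hartley lu)) lw => xi; exact: hartley_bounded.
under eq_Rintegral do rewrite E.
rewrite hartley_selfadjoint//.
have lu2 := l2u.2.
have [l2h i2h] := heat_mass b0 lu2 (fun x => sqr_ge0 (u x)).
have ->: ip u u = \int[mu]_x (2^-1 * u x ^+ 2 + 2^-1 * heat a^-1 (fun t => u t ^+ 2) x).
  rewrite RintegralD//; try exact: L1Z.
  rewrite !RintegralZl// i2h -mulrDl (_ : 2^-1 + 2^-1 = 1) ?mul1r; last by field.
  by apply: eq_Rintegral.
apply: le_Rintegral => //.
- apply: (@eq_L1 _ (fun x => hartley (fun xi => hartley u xi * gauss a xi) x * u x)) => [x|].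
    by rewrite mulrC.
  apply: (L1M_bounded (measurable_hartley lw)) lu => xi; exact: hartley_bounded.
- by apply: L1D; exact: L1Z.
move=> x _; rewrite hartley_gauss_hartley// /heat.
have [lk ik] := heat_kernel_integral x b0.
have kx t : heat_kernel a^-1 (x - t) = heat_kernel a^-1 (t - x).
  by rewrite -heat_kernelN opprB.
have K (r : R) : \int[mu]_t (r * heat_kernel a^-1 (x - t)) = r.
  by under eq_Rintegral do rewrite kx; rewrite RintegralZl// ik mulr1.
rewrite -[in X in _ <= X](K (2^-1 * u x ^+ 2)) -RintegralZl//; last exact: L1_heat_kernel.
rewrite -RintegralZl//; last exact: L1_heat_kernel.
rewrite -RintegralD//; last 2 first.
- by apply: L1Z; apply: eq_L1 lk => t; rewrite kx.
- by apply: L1Z; exact: L1_heat_kernel.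
apply: le_Rintegral => //.
- by apply: L1Z; exact: L1_heat_kernel.
- apply: L1D; first by apply: L1Z; apply: eq_L1 lk => t; rewrite kx.
  by apply: L1Z; exact: L1_heat_kernel.
move=> t _; rewrite -subr_ge0; set K' := heat_kernel _ _.
rewrite (_ : _ - _ = 2^-1 * (K' * (u x - u t) ^+ 2)); last by field.
by rewrite mulr_ge0 ?invr_ge0// mulr_ge0 ?sqr_ge0// heat_kernel_ge0.
Qed.

(** The Gaussian weights of parameter 1 / (n + 1) increase to 1, so the uniform bound passes to the
    limit by monotone convergence. Equality has to wait for Parseval. *)
Lemma hartley_plancherel_le u : L1 u -> sqint u ->
  sqint (hartley u) /\ ip (hartley u) (hartley u) <= ip u u.
Proof.
move=> lu l2u; have mh := measurable_hartley lu.
pose a n : R := n.+1%:R^-1.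
have a0 n : 0 < a n by rewrite invr_gt0.
have H : (\int[mu]_xi (hartley u xi ^+ 2)%:E <= (ip u u)%:E)%E.
  have C := @cvg_monotone_convergence _ _ R mu setT measurableT
    (fun n xi => (hartley u xi ^+ 2 * gauss (a n) xi)%:E).
  rewrite (_ : (fun xi => (hartley u xi ^+ 2)%:E) =
    (fun xi => limn (fun n => (hartley u xi ^+ 2 * gauss (a n) xi)%:E))); last first.
    apply/funext => xi; apply/esym/cvg_lim => //.
    apply: cvg_EFin; first exact: nearW.
    rewrite -[X in _ --> X]mulr1; apply: cvgM; first exact: cvg_cst.
    rewrite -(expR0 R) /gauss; apply: (cvg_comp _ expR); last exact: continuous_expR.
    rewrite -oppr0 -(mul0r (xi ^+ 2)); apply: (@cvgN _ R^o).
    apply: cvgM; last exact: cvg_cst.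
    by rewrite -(mulr0 pi); apply: cvgM; [exact: cvg_cst|exact: cvg_harmonic].
  have mg n : measurable_fun [set: R] (fun xi => (hartley u xi ^+ 2 * gauss (a n) xi)%:E).
    apply/measurable_EFinP; apply: measurable_funM; first exact: measurable_funX.
    exact: measurable_gauss.
  have {C} := C mg.
  have g0 n xi : setT xi -> (0 <= (hartley u xi ^+ 2 * gauss (a n) xi)%:E)%E.
    by move=> _; rewrite lee_fin mulr_ge0 ?sqr_ge0// gauss_ge0.
  have nd xi : setT xi -> {homo (fun n => (hartley u xi ^+ 2 * gauss (a n) xi)%:E) :
      n m / (n <= m)%N >-> (n <= m)%E}.
    move=> _ n m nm; rewrite lee_fin ler_wpM2l ?sqr_ge0// ler_expR lerN2.
    rewrite ler_wpM2r ?sqr_ge0// ler_wpM2l ?pi_ge0// lef_pV2 ?posrE//.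
    by rewrite ler_nat.
  move=> /(_ g0 nd) C.
  apply: (@cvge_le _ _ _ _ _ _ _ _ C); apply: nearW => n.
  have [l i] := hartley_sqr_gauss (a0 n) lu l2u.
  by rewrite Rintegral_fin// lee_fin.
have lh : sqint (hartley u).
  by apply: sqint_ip_lty => //; rewrite (le_lt_trans H)// ltry.
by split => //; rewrite -lee_fin -ip_fin.
Qed.

End HartleyTransform.

(** * Hermite functions *)

Section Hermite.
Context {R : realType}.
Implicit Types f g u v w : R -> R.
Local Notation mu := (@lebesgue_measure R).

Definition sqrt_pi : R := Num.sqrt pi.
Definition sqrt_nat (k : nat) : R := Num.sqrt k%:R.
Local Notation s := sqrt_pi.
Local Notation a := sqrt_nat.
Local Notation h := (@hermite_fun R).

Lemma sqrt_pi_gt0 : 0 < s. Proof. by rewrite sqrtr_gt0 pi_gt0. Qed.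
Lemma sqrt_pi_neq0 : s != 0. Proof. by rewrite gt_eqF// sqrt_pi_gt0. Qed.
Lemma sqr_sqrt_pi : pi = s ^+ 2. Proof. by rewrite sqr_sqrtr// pi_ge0. Qed.
Lemma sqr_sqrt_nat k : a k ^+ 2 = k%:R. Proof. by rewrite sqr_sqrtr. Qed.
Lemma sqrt_nat0 : a 0 = 0. Proof. by rewrite /sqrt_nat mulr0n sqrtr0. Qed.
Lemma sqrt_natS_neq0 k : a k.+1 != 0. Proof. by rewrite gt_eqF// sqrtr_gt0 ltr0n. Qed.

Definition gauss_derivn k : R -> R :=
  derive1n k (fun s : R => expR (- (2 * pi * s ^+ 2))).
Local Notation D := gauss_derivn.

(** [derive1n] carries no differentiability. Exhibiting the derivative E of one iterate both
    identifies the next iterate and shows that the present one is differentiable. *)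
Lemma gauss_derivn_next k (E : R -> R) : (forall t : R, is_derive t 1 (D k) (E t)) ->
  (forall t, D k.+1 t = E t) /\ (forall t : R, is_derive t 1 (D k) (D k.+1 t)).
Proof.
move=> dD; have DE t : D k.+1 t = E t.
  by rewrite /gauss_derivn derive1nS derive1E; have [_ ->] := dD t.
by split => // t; rewrite DE.
Qed.

Lemma is_derive_idfun (t : R) : is_derive t (1 : R) (fun t : R => t) 1.
Proof. exact: is_derive_id. Qed.

(** Differentiability and recurrence are proved together, since the recurrence is what makes the
    next derivative explicit. At k = 0 the term in [D k.-1] has coefficient 0. *)
Definition gauss_derivn_rec k := (forall t : R, is_derive t 1 (D k) (D k.+1 t)) /\
  (forall t, D k.+1 t = - (4 * pi) * (t * D k t + k%:R * D k.-1 t)).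

Lemma gauss_derivn_rec0 : gauss_derivn_rec 0.
Proof.
have D0 : D 0 = gauss 2.
  by apply/funext => t; rewrite /gauss_derivn /= /gauss; congr expR; ring.
have [E1 E2] : (forall t, D 1 t = - (4 * pi) * (t * D 0 t)) /\
    (forall t : R, is_derive t 1 (D 0) (D 1 t)).
  apply: gauss_derivn_next => t; rewrite D0; apply: is_derive_eq (is_derive_gauss 2 t) _; ring.
by split => // t; rewrite E1 mul0r addr0.
Qed.

Lemma gauss_derivn_rec1 : gauss_derivn_rec 1.
Proof.
have [dD0 D1] := gauss_derivn_rec0.
have [E1 E2] : (forall t, D 2 t = - (4 * pi) * (t * D 1 t + 1 * D 0 t)) /\
    (forall t : R, is_derive t 1 (D 1) (D 2 t)); last by [].
apply: gauss_derivn_next => t.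
rewrite (_ : D 1 = fun t => - (4 * pi) * (t * D 0 t)); last first.
  by apply/funext => x; rewrite D1 mul0r addr0.
apply: is_derive_eq (is_deriveZ_fun _ (is_deriveM_fun (is_derive_idfun t) (dD0 t))) _.
by rewrite D1 /=; ring.
Qed.

Lemma gauss_derivn_recS k : gauss_derivn_rec k -> gauss_derivn_rec k.+1 -> gauss_derivn_rec k.+2.
Proof.
move=> [dk Dk] [dk1 Dk1].
have [E1 E2] : (forall t, D k.+3 t = - (4 * pi) * (t * D k.+2 t + k.+2%:R * D k.+1 t)) /\
    (forall t : R, is_derive t 1 (D k.+2) (D k.+3 t)); last by [].
apply: gauss_derivn_next => t.
rewrite (_ : D k.+2 = fun t => - (4 * pi) * (t * D k.+1 t + k.+1%:R * D k t)); last first.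
  exact/funext.
apply: is_derive_eq (is_deriveZ_fun _ (is_deriveD_fun (is_deriveM_fun (is_derive_idfun t) (dk1 t))
  (is_deriveZ_fun _ (dk t)))) _.
by rewrite [D k.+2 t]Dk1 /= -!natr1; ring.
Qed.

Lemma gauss_derivnP k : gauss_derivn_rec k.
Proof.
suff H : gauss_derivn_rec k /\ gauss_derivn_rec k.+1 by exact: (proj1 H).
elim: k => [|k [IH1 IH2]]; first exact: (conj gauss_derivn_rec0 gauss_derivn_rec1).
exact: (conj IH2 (gauss_derivn_recS IH1 IH2)).
Qed.

Definition hermite_coef (k : nat) : R :=
  2 `^ 4^-1 / Num.sqrt k`!%:R * (- (2 * s)^-1) ^+ k.

Local Notation c := hermite_coef.

Lemma hermite_coefS k : c k.+1 = c k * (- (2 * s)^-1) / a k.+1.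
Proof.
rewrite /hermite_coef factS natrM sqrtrM// -/(sqrt_nat k.+1) exprS.
by field; rewrite sqrt_pi_neq0 sqrt_natS_neq0 gt_eqF// sqrtr_gt0 ltr0n fact_gt0.
Qed.

Lemma hermite_funE k t : h k t = c k * expR (pi * t ^+ 2) * D k t.
Proof. by []. Qed.

Lemma hermite_fun0 : h 0 = fun t => 2 `^ 4^-1 * gauss 1 t.
Proof.
apply/funext => t; rewrite hermite_funE /hermite_coef fact0 sqrtr1 expr0 invr1 !mulr1 -mulrA; congr (_ * _).
by rewrite /gauss_derivn /= -expRD /gauss; congr expR; ring.
Qed.

(** The recurrence of the Gaussian derivatives, rescaled by the normalising constants. At k = 0,
    where [k.-1] is again 0, the factor [sqrt_nat 0] removes the spurious term; the same convention
    is used in all recurrences below. *)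
Lemma hermite_fun_recurrence k t : 2 * s * (t * h k t) =
  a k.+1 * h k.+1 t + a k * h k.-1 t.
Proof.
have [_ Dk] := gauss_derivnP k.
rewrite !hermite_funE hermite_coefS Dk sqr_sqrt_pi.
case: k Dk => [|k] Dk.
  move: (D 0 t) (D 0.-1 t) => d d'.
  rewrite sqrt_nat0; field; rewrite ?sqrt_pi_neq0 ?sqrt_natS_neq0//.
rewrite hermite_coefS -(sqr_sqrt_nat k.+1) /=; field; rewrite ?sqrt_pi_neq0 ?sqrt_natS_neq0//.
Qed.

Lemma is_derive_hermite_fun k (t : R) :
  is_derive t 1 (h k) (s * (a k * h k.-1 t - a k.+1 * h k.+1 t)).
Proof.
have [dk Dk] := gauss_derivnP k.
have := is_deriveM_fun (is_derive_gauss (- 1) t) (dk t).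
move=> /(is_deriveZ_fun (c k)).
rewrite (_ : (fun t => _) = h k); last first.
  apply/funext => x; rewrite hermite_funE mulrA; congr (_ * _ * _).
  by rewrite /gauss; congr expR; ring.
move=> E; apply: is_derive_eq E _.
have R1 := hermite_fun_recurrence k t.
have E1 : a k.+1 * h k.+1 t = - (2 * s)^-1 * (c k * expR (pi * t ^+ 2) * D k.+1 t).
  by rewrite hermite_funE hermite_coefS; field; rewrite sqrt_pi_neq0 sqrt_natS_neq0.
have E2 : gauss (- 1) t = expR (pi * t ^+ 2).
  by rewrite /gauss; congr expR; ring.
have E3 : a k * h k.-1 t = 2 * s * (t * h k t) - a k.+1 * h k.+1 t.
  by rewrite R1; ring.
by rewrite E3 E1 E2 hermite_funE sqr_sqrt_pi; field; rewrite sqrt_pi_neq0.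
Qed.

End Hermite.

(** * Ladder operators, orthonormality and Hartley eigenfunctions *)

Section HermiteBasis.
Context {R : realType}.
Implicit Types f g u v w : R -> R.
Local Notation mu := (@lebesgue_measure R).
Local Notation s := (@sqrt_pi R).
Local Notation a := (@sqrt_nat R).
Local Notation h := (@hermite_fun R).

Lemma hermite_funS k t :
  h k.+1 t = (a k.+1)^-1 * (2 * s * (t * h k t) - a k * h k.-1 t).
Proof. by rewrite hermite_fun_recurrence addrK mulKf// sqrt_natS_neq0. Qed.

(** Induction shaped by the three-term recurrence, which has no lower neighbour at 0: hence [P 1]
    follows from [P 0] alone. *)
Lemma hermite_fun_ind (P : nat -> Prop) : P 0 -> (P 0 -> P 1) ->
  (forall k, P k -> P k.+1 -> P k.+2) -> forall k, P k.
Proof.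
move=> P0 P1 PS k; suff H : P k /\ P k.+1 by exact: (proj1 H).
elim: k => [|k [H1 H2]]; first exact: (conj P0 (P1 P0)).
exact: (conj H2 (PS k H1 H2)).
Qed.

Lemma gdecay_hermite_fun k : gdecay (h k).
Proof.
elim/hermite_fun_ind: k => [|IH|k IH1 IH2].
- by rewrite hermite_fun0; exact/gdecayZ/gdecay_gauss.
- rewrite (_ : h 1 = fun t => (a 1)^-1 * (2 * s) * (t * h 0 t)).
    exact/gdecayZ/gdecayXM.
  by apply/funext => t; rewrite hermite_funS sqrt_nat0; ring.
- rewrite (_ : h k.+2 = fun t => (a k.+2)^-1 * (2 * s) * (t * h k.+1 t)
      + (- ((a k.+2)^-1 * a k.+1)) * h k t).
    by apply: gdecayD; apply: gdecayZ => //; exact: gdecayXM.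
  by apply/funext => t; rewrite hermite_funS /=; ring.
Qed.

Lemma sqint_hermite_fun k : sqint (h k).
Proof. exact/gdecay_sqint/gdecay_hermite_fun. Qed.

Lemma hermite_funN k t : h k (- t) = (-1) ^+ k * h k t.
Proof.
elim/hermite_fun_ind: k => [|IH|k IH1 IH2].
- by rewrite hermite_fun0 /= gaussN expr0 mul1r.
- by rewrite !hermite_funS IH sqrt_nat0; ring.
- rewrite (hermite_funS k.+1 (- t)) (hermite_funS k.+1 t) /= IH1 IH2 !exprS; ring.
Qed.

(** The creation operator 2 pi t - d/dt, the subtracted term being the derivative of h_k. *)
Lemma hermite_raising k t : 2 * pi * (t * h k t) -
  s * (a k * h k.-1 t - a k.+1 * h k.+1 t) = 2 * s * a k.+1 * h k.+1 t.
Proof.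
have -> : 2 * pi * (t * h k t) = s * (2 * s * (t * h k t)).
  by rewrite sqr_sqrt_pi; ring.
by rewrite hermite_fun_recurrence; ring.
Qed.

(** The annihilation operator 2 pi t + d/dt. *)
Lemma hermite_lowering k t : 2 * pi * (t * h k t) +
  s * (a k * h k.-1 t - a k.+1 * h k.+1 t) = 2 * s * a k * h k.-1 t.
Proof.
have -> : 2 * pi * (t * h k t) = s * (2 * s * (t * h k t)).
  by rewrite sqr_sqrt_pi; ring.
by rewrite hermite_fun_recurrence; ring.
Qed.

(* Integration by parts against any smooth g moves the lowering operator
   from h_k to g as a raising operator. *)
Lemma ip_hermite_raising k (g g' : R -> R) :
  (forall x : R, is_derive x 1 g (g' x)) -> gdecay g -> gdecay g' ->
  2 * s * a k.+1 * ip (h k.+1) g = ip (h k) (fun t => 2 * pi * (t * g t) + g' t).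
Proof.
move=> dg gg gg'.
pose h' t := s * (a k * h k.-1 t - a k.+1 * h k.+1 t).
have gh' : gdecay h'.
  have := gdecayD (gdecayZ (s * a k) (gdecay_hermite_fun k.-1))
    (gdecayZ (- (s * a k.+1)) (gdecay_hermite_fun k.+1)).
  by congr gdecay; apply/funext => t; rewrite /h'; ring.
have gh := gdecay_hermite_fun k.
have lh := gdecay_sqint gh; have lh' := gdecay_sqint gh'.
have lg := gdecay_sqint gg; have lg' := gdecay_sqint gg'.
have lth := gdecay_sqint (gdecayXM gh); have ltg := gdecay_sqint (gdecayXM gg).
have I : ip h' g = - ip (h k) g'.
  exact: (Rintegral_by_parts (is_derive_hermite_fun k) dg (gdecayM gh gg)
    (gdecayM gh gg') (gdecayM gh' gg)).
rewrite -ipZl//; last exact: sqint_hermite_fun.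
rewrite (eq_ip (f' := fun t => 2 * pi * (t * h k t) - h' t) (g' := g)) => [|t|//]; last first.
  by rewrite hermite_raising.
rewrite ipBl//; last exact: sqintZ.
rewrite ipDr//; last exact: sqintZ.
rewrite I opprK; congr (_ + _).
by apply: eq_Rintegral => t _; ring.
Qed.

(** Raising on the left is lowering on the right, so both indices descend together until one of them
    is 0. If the other is still positive, [sqrt_nat 0] makes the product vanish. *)
Lemma hermite_orthonormal j k : ip (h j) (h k) = (j == k)%:R.
Proof.
have rec i l : a i.+1 * ip (h i.+1) (h l) = a l * ip (h i) (h l.-1).
  have s2 : 2 * s != 0 by rewrite mulf_neq0// sqrt_pi_neq0.
  apply: (mulfI s2); rewrite mulrA.
  rewrite (@ip_hermite_raising i _ _ (is_derive_hermite_fun l)); last 2 first.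
  - exact: gdecay_hermite_fun.
  - have := gdecayD (gdecayZ (s * a l) (gdecay_hermite_fun l.-1))
      (gdecayZ (- (s * a l.+1)) (gdecay_hermite_fun l.+1)).
    by congr gdecay; apply/funext => t; ring.
  rewrite (eq_ip (f' := h i) (g' := fun t => 2 * s * a l * h l.-1 t))//; last first.
    by move=> t; rewrite hermite_lowering.
  by rewrite ipZr ?mulrA//; exact: sqint_hermite_fun.
have i0 i : ip (h i.+1) (h 0) = 0.
  by apply: (mulfI (sqrt_natS_neq0 i)); rewrite rec sqrt_nat0 mul0r mulr0.
elim: j k => [|j IH] [|k].
(* The factor 2^(1/4) squares to sqrt 2, the inverse of the integral of [gauss 2]. *)
- rewrite eqxx /ip hermite_fun0.
  transitivity (\int[mu]_t ((2 `^ 4^-1 * 2 `^ 4^-1) * gauss 2 t)).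
    apply: eq_Rintegral => t _; rewrite mulrACA; congr (_ * _).
    by rewrite /gauss -expRD; congr expR; ring.
  rewrite RintegralZl ?integral_gauss//; last exact: L1_gauss.
  rewrite -powRD; last by rewrite pnatr_eq0 implybT.
  rewrite (_ : 4^-1 + 4^-1 = 2^-1 :> R); last by field.
  by rewrite powR12_sqrt// mulfV// gt_eqF// sqrtr_gt0.
- by rewrite ipC i0.
- by rewrite i0.
- apply: (mulfI (sqrt_natS_neq0 j)); rewrite rec IH eqSS.
  by case: eqP => [->|_]; rewrite ?mulr0.
Qed.

(** The pattern 1, 1, -1, -1: the real counterpart of the Fourier eigenvalues (-i)^k. *)
Definition hartley_sign k : R := (-1) ^+ k./2.

Lemma hartley_signS k : hartley_sign k.+1 = (-1) ^+ k * hartley_sign k.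
Proof.
rewrite /hartley_sign -exprD -signr_odd -[RHS]signr_odd; congr ((-1) ^+ nat_of_bool _).
rewrite oddD -uphalfE uphalf_half oddD; case: (odd k) => //.
Qed.

Lemma hartley_sign_sqr k : hartley_sign k ^+ 2 = 1.
Proof. by rewrite /hartley_sign -exprM mulnC exprM sqrrN expr1n expr1n. Qed.

Lemma L1_hermite_fun k : L1 (h k).
Proof. exact/gdecay_L1/gdecay_hermite_fun. Qed.

Definition gauss_cas (xi t : R) : R := gauss 1 t * cas (2 * pi * t * xi).

(** Integrating the derivative of h_k by parts against the kernel produces multiplication by xi
    together with the reflection of xi. *)
Lemma hartley_hermite_rec k xi : a k.+1 * hartley (h k.+1) xi =
  a k * hartley (h k.-1) xi + 2 * s * (xi * hartley (h k) (- xi)).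
Proof.
have c2 (b : R) : continuous (fun t : R => cas (2 * pi * t * b)).
  rewrite (_ : (fun t => _) = (fun t => cas (2 * pi * b * t))).
    exact: (continuous_linear_comp continuous_cas).
  by apply/funext => t; congr cas; ring.
have gc k' b : gdecay (fun t => h k' t * cas (2 * pi * t * b)).
  have := gdecayM_bounded (c2 b) (fun t => cas_normr_le2 _) (gdecay_hermite_fun k').
  by congr gdecay; apply/funext => t; rewrite mulrC.
have I := @Rintegral_by_parts R (h k) _ (fun t => cas (2 * pi * t * xi))
  (fun t => 2 * pi * xi * cas (2 * pi * t * (- xi))) (is_derive_hermite_fun k).
have s0 : s != 0 by exact: sqrt_pi_neq0.
apply: (mulfI s0).
have dcas (x : R) : is_derive x 1 (fun t => cas (2 * pi * t * xi))
    (2 * pi * xi * cas (2 * pi * x * (- xi))).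
  have := is_derive_cas (2 * pi * xi) x.
  rewrite (_ : (fun t => _) = (fun t => cas (2 * pi * t * xi))); last first.
    by apply/funext => t; congr cas; ring.
  by move=> E; apply: is_derive_eq E _; congr (_ * cas _); ring.
have g1 : gdecay (fun t => h k t * (2 * pi * xi * cas (2 * pi * t * (- xi)))).
  have := gdecayZ (2 * pi * xi) (gc k (- xi)).
  by congr gdecay; apply/funext => t; ring.
have g2 : gdecay (fun t => s * (a k * h k.-1 t - a k.+1 * h k.+1 t) * cas (2 * pi * t * xi)).
  have := gdecayD (gdecayZ (s * a k) (gc k.-1 xi)) (gdecayZ (- (s * a k.+1)) (gc k.+1 xi)).
  by congr gdecay; apply/funext => t; ring.
have {}I := I dcas (gc k xi) g1 g2.
have H : \int[mu]_t (s * (a k * h k.-1 t - a k.+1 * h k.+1 t) * cas (2 * pi * t * xi)) =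
  s * a k * hartley (h k.-1) xi - s * a k.+1 * hartley (h k.+1) xi.
  rewrite /hartley -RintegralZl//; last exact: gdecay_L1.
  rewrite -RintegralZl//; last exact: gdecay_L1.
  rewrite -RintegralB//; try exact/L1Z/gdecay_L1.
  by apply: eq_Rintegral => t _; ring.
have H2 : \int[mu]_t (h k t * (2 * pi * xi * cas (2 * pi * t * - xi))) =
  2 * pi * xi * hartley (h k) (- xi).
  rewrite /hartley -RintegralZl//; last exact: gdecay_L1.
  by apply: eq_Rintegral => t _; ring.
move: I; rewrite H H2 => I.
have E : s * a k.+1 * hartley (h k.+1) xi =
    s * a k * hartley (h k.-1) xi + 2 * pi * xi * hartley (h k) (- xi).
  by rewrite -[X in _ = _ + X]opprK -I; ring.
by rewrite [LHS]mulrA E sqr_sqrt_pi; ring.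
Qed.

Lemma cas0 : cas 0 = 1 :> R.
Proof. by rewrite /cas cos0 sin0 addr0. Qed.

Lemma hartley_gauss (xi : R) : hartley (gauss 1) xi = gauss 1 xi.
Proof.
have := cas_transform_gauss xi 0 (@ltr01 R).
rewrite sqrtr1 invr1 mul1r subr0 => <-; apply: eq_Rintegral => t _.
by rewrite mulr0 cas0 mulr1.
Qed.

(** Once parity absorbs the reflection, the transforms obey, up to signs, the recurrence of the h_k
    themselves, and they start from the same Gaussian. *)
Lemma hartley_hermite k xi : hartley (h k) xi = hartley_sign k * h k xi.
Proof.
have H0 x : hartley (h 0) x = h 0 x.
  rewrite hermite_fun0 /= -hartley_gauss /hartley -RintegralZl//; last first.
    exact/L1_cas/L1_gauss.
  by apply: eq_Rintegral => t _; rewrite mulrA.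
elim/hermite_fun_ind: k xi => [xi|IH xi|k IH1 IH2 xi].
- by rewrite H0 /hartley_sign expr0 mul1r.
- apply: (mulfI (sqrt_natS_neq0 0)).
  rewrite hartley_hermite_rec H0 sqrt_nat0 mul0r add0r hermite_funN hartley_signS.
  have := hermite_fun_recurrence 0 xi; rewrite sqrt_nat0 mul0r addr0 => E0.
  by rewrite [RHS]mulrCA -E0 /hartley_sign; ring.
- apply: (mulfI (sqrt_natS_neq0 k.+1)).
  rewrite hartley_hermite_rec /= IH1 IH2 hermite_funN.
  rewrite [RHS]mulrCA (_ : a k.+2 * h k.+2 xi =
    2 * s * (xi * h k.+1 xi) - a k.+1 * h k xi); last first.
    by rewrite hermite_fun_recurrence /=; ring.
  rewrite !hartley_signS !exprS.
  have E : (-1) ^+ k * (-1) ^+ k = 1 :> R by rewrite -expr2 -exprM mulnC exprM sqrrN !expr1n.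
  rewrite (_ : -1 * (-1) ^+ k * ((-1) ^+ k * hartley_sign k) =
     - ((-1) ^+ k * (-1) ^+ k) * hartley_sign k); last by ring.
  rewrite (_ : (-1) ^+ k * hartley_sign k * (-1 * (-1) ^+ k * h k.+1 xi) =
     - ((-1) ^+ k * (-1) ^+ k) * hartley_sign k * h k.+1 xi); last by ring.
  by rewrite E; ring.
Qed.

Lemma gdecay_gauss_cas xi : gdecay (gauss_cas xi).
Proof.
have c2 : continuous (fun t : R => cas (2 * pi * t * xi)).
  rewrite (_ : (fun t => _) = (fun t => cas (2 * pi * xi * t))).
    exact: (continuous_linear_comp continuous_cas).
  by apply/funext => t; congr cas; ring.
have := gdecayM_bounded c2 (fun t => cas_normr_le2 _) (gdecay_gauss (@ltr01 R)).
by congr gdecay; apply/funext => t; rewrite mulrC.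
Qed.

Lemma sqint_gauss_cas xi : sqint (gauss_cas xi).
Proof. exact/gdecay_sqint/gdecay_gauss_cas. Qed.

(** The operator 2 pi t + d/dt annihilates the Gaussian factor, so only the derivative of the kernel
    survives. *)
Lemma ip_hermite_gauss_cas_rec k xi :
  a k.+1 * ip (h k.+1) (gauss_cas xi) = s * xi * ip (h k) (gauss_cas (- xi)).
Proof.
have dg (x : R) : is_derive x 1 (gauss_cas xi)
    (2 * pi * xi * gauss_cas (- xi) x - 2 * pi * (x * gauss_cas xi x)).
  have dcas := is_derive_cas (2 * pi * xi) x.
  have := is_deriveM_fun (is_derive_gauss 1 x) dcas.
  rewrite (_ : (fun t => _) = gauss_cas xi); last first.
    by apply/funext => t; rewrite /gauss_cas; congr (_ * cas _); ring.
  move=> E; apply: is_derive_eq E _; rewrite /gauss_cas.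
  rewrite (_ : - (2 * pi * xi * x) = 2 * pi * x * - xi); last by ring.
  rewrite (_ : 2 * pi * xi * x = 2 * pi * x * xi); last by ring.
  ring.
have g2 : gdecay (fun x => 2 * pi * xi * gauss_cas (- xi) x - 2 * pi * (x * gauss_cas xi x)).
  have := gdecayD (gdecayZ (2 * pi * xi) (gdecay_gauss_cas (- xi)))
    (gdecayZ (- (2 * pi)) (gdecayXM (gdecay_gauss_cas xi))).
  by congr gdecay; apply/funext => t; ring.
have H := ip_hermite_raising k dg (gdecay_gauss_cas xi) g2.
have s2 : 2 * s != 0 by rewrite mulf_neq0// sqrt_pi_neq0.
apply: (mulfI s2); rewrite mulrA H.
rewrite (eq_ip (f' := h k) (g' := fun t => 2 * pi * xi * gauss_cas (- xi) t))//; last first.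
  by move=> t; ring.
rewrite ipZr; [|exact: sqint_hermite_fun|exact: sqint_gauss_cas].
by rewrite sqr_sqrt_pi; ring.
Qed.

(** Each step of the recurrence multiplies the square by pi xi^2 / (k + 1); the reflection
    disappears because the formula is even in xi. Up to the factor 1 / sqrt 2 these are the Poisson
    weights of parameter pi xi^2, so they exhaust the squared norm. *)
Lemma ip_hermite_gauss_cas_sqr k xi : ip (h k) (gauss_cas xi) ^+ 2 =
  exp_coeff (pi * xi ^+ 2) k * ((Num.sqrt 2)^-1 * gauss 1 xi).
Proof.
elim: k xi => [|k IH] xi.
  rewrite /exp_coeff /= expr0 fact0 divr1 mul1r.
  have -> : ip (h 0) (gauss_cas xi) = 2 `^ 4^-1 * ((Num.sqrt 2)^-1 * gauss 2^-1 xi).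
    have := cas_transform_gauss xi 0 (ltr0Sn R 1).
    rewrite subr0 => <-; rewrite -RintegralZl//; last first.
      apply: (@eq_L1 _ (fun t => gauss 2 t * cas (2 * pi * t * xi))) => [t|].
        by rewrite mulr0 cas0 mulr1.
      exact/L1_cas/L1_gauss.
    apply: eq_Rintegral => t _; rewrite hermite_fun0 /gauss_cas mulr0 cas0 mulr1.
    rewrite -mulrA; congr (_ * _); rewrite mulrA; congr (_ * _).
    by rewrite /gauss -expRD; congr expR; ring.
  rewrite !exprMn [_ `^ _ ^+ 2]expr2 -powRD; last by rewrite pnatr_eq0 implybT.
  rewrite (_ : 4^-1 + 4^-1 = 2^-1 :> R); last by field.
  rewrite powR12_sqrt// (_ : gauss 2^-1 xi ^+ 2 = gauss 1 xi); last first.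
    by rewrite /gauss expr2 -expRD; congr expR; field.
  by field; rewrite gt_eqF// sqrtr_gt0.
have E : (a k.+1 * ip (h k.+1) (gauss_cas xi)) ^+ 2 =
    (s * xi * ip (h k) (gauss_cas (- xi))) ^+ 2 by rewrite ip_hermite_gauss_cas_rec.
have k1 : k.+1%:R != 0 :> R by rewrite pnatr_eq0.
apply: (mulfI k1); move: E; rewrite exprMn sqr_sqrt_nat => ->.
rewrite exprMn IH exprMn -sqr_sqrt_pi sqrrN gaussN.
rewrite /exp_coeff /= [(_ * _) ^+ k.+1]exprS factS natrM.
have k2 : k`!%:R != 0 :> R by rewrite pnatr_eq0 -lt0n fact_gt0.
have k3 : Num.sqrt 2 != 0 :> R by rewrite gt_eqF// sqrtr_gt0.
move: (gauss 1 xi) (pi : R) (Num.sqrt 2) k3 (k`!%:R : R) k2 (k.+1%:R) k1 => G p r k3 f k2 n k1.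
by field; rewrite k1 k2 k3.
Qed.

Lemma ip_gauss_cas xi : ip (gauss_cas xi) (gauss_cas xi) = (Num.sqrt 2)^-1.
Proof.
have := cas_transform_gauss xi xi (ltr0Sn R 1).
rewrite subrr {2}/gauss expr0n/= mulr0 oppr0 expR0 mulr1 => <-.
apply: eq_Rintegral => t _; rewrite /gauss_cas.
rewrite mulrACA -[RHS]mulrA; congr (_ * _).
by rewrite /gauss -expRD; congr expR; ring.
Qed.

Lemma gauss_cas_residual_cvg0 xi :
  (fun n => ip (fun x => gauss_cas xi x - projsum h n (gauss_cas xi) x)
     (fun x => gauss_cas xi x - projsum h n (gauss_cas xi) x)) @ \oo --> (0 : R).
Proof.
rewrite (_ : (fun n => _) = (fun n => (Num.sqrt 2)^-1 -
    series (exp_coeff (pi * xi ^+ 2)) n * ((Num.sqrt 2)^-1 * gauss 1 xi))); last first.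
  apply/funext => n; rewrite ip_residual_residual; last 3 first.
  - exact: sqint_hermite_fun.
  - exact: hermite_orthonormal.
  - exact: sqint_gauss_cas.
  rewrite ip_gauss_cas /series /= mulr_suml big_mkord; congr (_ - _).
  by apply: eq_bigr => i _; rewrite ipC ip_hermite_gauss_cas_sqr.
have -> : (0 : R) = (Num.sqrt 2)^-1 - expR (pi * xi ^+ 2) * ((Num.sqrt 2)^-1 * gauss 1 xi).
  rewrite mulrCA /gauss -expRD mulr1 subrr expR0 mulr1 subrr//.
apply: cvgB; first exact: cvg_cst.
by apply: cvgM; [exact: is_cvg_series_exp_coeff|exact: cvg_cst].
Qed.

End HermiteBasis.

(** * Parseval's identity for the Hermite functions *)

Section ApproximateIdentity.
Context {R : realType}.
Implicit Types f g u v w q : R -> R.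
Local Notation mu := (@lebesgue_measure R).

(** Within distance N / m of 0 the kernel is at most m. Beyond it, half of the Gaussian exponent
    yields the factor C / N^2 and the other half remains as a wider kernel, still of mass 1. *)
Lemma heat_kernel_tail : exists2 C : R, 0 <= C &
  forall m N z : R, 0 < m -> 0 < N ->
    heat_kernel (m ^+ 2) z <= m * (`|z| < N / m)%R%:R + C / N ^+ 2 * heat_kernel (m ^+ 2 / 2) z.
Proof.
have [C HC] := @exprM_gauss_bounded R 2 2^-1 (ltac:(by rewrite invr_gt0)).
have C0 : 0 <= C.
  by apply: le_trans (HC 0); rewrite mulr_ge0 ?exprn_ge0// gauss_ge0.
exists (Num.sqrt 2 * C) => [|m N z m0 N0]; first by rewrite mulr_ge0.
have m2 : Num.sqrt (m ^+ 2) = m by rewrite sqrtr_sqr gtr0_norm.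
have r2 : Num.sqrt 2 != 0 :> R by rewrite gt_eqF// sqrtr_gt0.
rewrite /heat_kernel m2 (sqrtrM (2^-1)) ?sqr_ge0// m2 sqrtrV//.
rewrite (_ : _ / N ^+ 2 * _ = m * (C / N ^+ 2 * gauss (m ^+ 2 / 2) z)); last first.
  by field; rewrite r2 gt_eqF.
rewrite -mulrDr ler_pM2l//.
have tail0 : 0 <= C / N ^+ 2 * gauss (m ^+ 2 / 2) z.
  by rewrite mulr_ge0 ?gauss_ge0// divr_ge0// sqr_ge0.
case: ltP => zN.
  rewrite (le_trans (gauss_le1 _ (sqr_ge0 m)))// lerDl//.
rewrite add0r.
have -> : gauss (m ^+ 2) z = gauss (m ^+ 2 / 2) z * gauss (m ^+ 2 / 2) z.
  by rewrite /gauss -expRD; congr expR; field.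
rewrite ler_wpM2r ?gauss_ge0// ler_pdivlMr ?exprn_gt0//.
have -> : gauss (m ^+ 2 / 2) z = gauss 2^-1 (m * z).
  by rewrite /gauss; congr expR; field.
apply: le_trans (HC (m * z)); rewrite mulrC ler_wpM2r ?gauss_ge0//.
rewrite normrM (gtr0_norm m0) lerXn2r ?nnegrE ?mulr_ge0 ?(ltW m0) ?(ltW N0)//.
by move: zN; rewrite ler_pdivrMr// mulrC.
Qed.

Lemma heat_bounded b q (M : R) x : 0 < b -> L1 q -> (forall t, `|q t| <= M) ->
  `|heat b q x| <= M.
Proof.
move=> b0 lq qM; have lk := L1_heat_kernel x b0 lq.
have kx t : heat_kernel b (x - t) = heat_kernel b (t - x) :> R.
  by rewrite -heat_kernelN opprB.
have [lK iK] := heat_kernel_integral x b0.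
rewrite (le_trans (le_normr_Rintegral _ lk))//.
apply: (@le_trans _ _ (\int[mu]_t (M * heat_kernel b (t - x)))).
  apply: le_Rintegral => //; [exact: L1_norm|exact: L1Z|] => t _.
  by rewrite normrM kx (ger0_norm (heat_kernel_ge0 _ _)) ler_wpM2r ?heat_kernel_ge0.
by rewrite RintegralZl// iK mulr1.
Qed.

(** [heat_kernel_tail] splits the error into a multiple of the mean of |q x - q t| over a ball of
    radius N / m, small at a Lebesgue point, and a tail that N makes small uniformly in m. *)
Lemma heat_cvg_lebesgue_pt q (M x : R) : L1 q -> (forall t, `|q t| <= M) ->
  lebesgue_pt q x -> (fun n => heat (n.+1%:R ^+ 2) q x) @ \oo --> q x.
Proof.
move=> lq qM Lx; have mq := L1_measurable lq.
have [C C0 HC] := heat_kernel_tail.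
have M0 : 0 <= M by apply: le_trans (qM 0).
have kx b t : heat_kernel b (x - t) = heat_kernel b (t - x) :> R.
  by rewrite -heat_kernelN opprB.
apply/cvgrPdist_le => e e0.
(* Since N >= 1 and N >= 4 M C / e, the tail 2 M C / N^2 is at most e / 2. *)
pose N := 1 + 4 * M * C / e.
have NM : 0 <= 4 * M * C / e by rewrite divr_ge0 ?mulr_ge0// ltW.
have N1 : 1 <= N by rewrite lerDl.
have N0 : 0 < N by rewrite (lt_le_trans ltr01).
have tail : 2 * M * (C / N ^+ 2) <= e / 2.
  rewrite mulrA ler_pdivrMr ?exprn_gt0//.
  apply: (@le_trans _ _ (e / 2 * N)); last first.
    by rewrite ler_wpM2l ?divr_ge0 ?(ltW e0)// expr2 ler_peMl// ltW.
  rewrite /N mulrDr mulr1 (_ : e / 2 * (4 * M * C / e) = 2 * M * C); last first.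
    by field; rewrite gt_eqF.
  by rewrite lerDr divr_ge0// ltW.
(* The ball has measure 2 N / m and the kernel is at most m: an average below d contributes at most
   e / 2. *)
pose d := e / 2 / (2 * N).
have d0 : 0 < d by rewrite !divr_gt0// mulr_gt0.
have [r /= r0 Hr] : \forall r \near (0:R)^'+, (davg q x r < d%:E)%E.
  apply: (Lx [set y | (y < d%:E)%E]); apply: open_nbhs_nbhs.
  by split; [exact: open_ereal_lt_ereal|rewrite /= lte_fin].
near=> n.
set m : R := n.+1%:R; have m0 : 0 < m by rewrite ltr0n.
have b0 : 0 < m ^+ 2 by rewrite exprn_gt0.
have b20 : 0 < m ^+ 2 / 2 by rewrite divr_gt0.
have Nm0 : 0 < N / m by rewrite divr_gt0.
have [lK iK] := heat_kernel_integral x b0.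
have [lK2 iK2] := heat_kernel_integral x b20.
have lK' : L1 (fun t => heat_kernel (m ^+ 2) (x - t)) by apply: eq_L1 lK => t; rewrite kx.
have lK2' : L1 (fun t => heat_kernel (m ^+ 2 / 2) (x - t)).
  by apply: eq_L1 lK2 => t; rewrite kx.
have mqx : measurable_fun [set: R] (fun t => q x - q t) by exact: measurable_funB.
have qx2 t : `|q x - q t| <= 2 * M.
  by rewrite (le_trans (ler_normB _ _))// mulr_natl mulr2n lerD.
have lD : L1 (fun t => (q x - q t) * heat_kernel (m ^+ 2) (x - t)).
  exact: (L1M_bounded mqx qx2).
have -> : q x - heat (m ^+ 2) q x = \int[mu]_t ((q x - q t) * heat_kernel (m ^+ 2) (x - t)).
  transitivity (\int[mu]_t (q x * heat_kernel (m ^+ 2) (x - t)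
      - q t * heat_kernel (m ^+ 2) (x - t))); last first.
    by apply: eq_Rintegral => t _; rewrite mulrBl.
  rewrite RintegralB//; [|exact: L1Z|exact: L1_heat_kernel].
  rewrite RintegralZl//; congr (_ - _).
  by under eq_Rintegral do rewrite kx; rewrite iK mulr1.
rewrite (le_trans (le_normr_Rintegral _ lD))//.
pose B := ball x (N / m).
have mB : measurable B by exact: measurable_ball.
have lB : L1 (fun t => \1_B t * `|q x - q t|).
  apply: (@eq_L1 _ (fun t => `|q x - q t| * \1_B t)) => [t|]; first by rewrite mulrC.
  apply: (L1M_bounded (C := 2 * M)).
  - exact: measurableT_comp.
  - by move=> t; rewrite normr_id.
  - apply/integrableP; split; first exact/measurable_EFinP/measurable_indic.
    under eq_integral do rewrite /= ger0_norm//.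
    by rewrite integral_indic//= setIT lebesgue_measure_ball ?ltry// ltW.
apply: (@le_trans _ _ (\int[mu]_t (m * (\1_B t * `|q x - q t|)
    + 2 * M * (C / N ^+ 2) * heat_kernel (m ^+ 2 / 2) (x - t)))).
  apply: le_Rintegral => //; first exact: L1_norm.
    by apply: L1D; exact: L1Z.
  move=> t _; rewrite normrM (ger0_norm (heat_kernel_ge0 _ _)).
  have HK := HC m N (x - t) m0 N0.
  have -> : \1_B t = (`|x - t| < N / m)%R%:R :> R.
    by rewrite indicE; congr (nat_of_bool _)%:R; apply/idP/idP; rewrite inE.
  rewrite (le_trans (ler_wpM2l (normr_ge0 _) HK))// mulrDr lerD//.
    by rewrite mulrCA ler_wpM2l ?(ltW m0)// mulrC.
  rewrite [leLHS]mulrA ler_wpM2r ?heat_kernel_ge0//.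
  by rewrite ler_wpM2r ?qx2// divr_ge0// sqr_ge0.
rewrite RintegralD//; [|exact: L1Z|exact: L1Z].
rewrite RintegralZl// RintegralZl//.
have -> : \int[mu]_t heat_kernel (m ^+ 2 / 2) (x - t) = 1.
  by rewrite -[RHS]iK2; apply: eq_Rintegral => t _; rewrite kx.
rewrite mulr1 [leRHS](_ : _ = e / 2 + e / 2); last by field.
rewrite lerD//.
have : (davg q x (N / m) < d%:E)%E.
  apply: Hr => //=; rewrite sub0r normrN gtr0_norm// ltr_pdivrMr// -ltr_pdivrMl//.
  apply: (@lt_trans _ _ n%:R); last by rewrite ltr_nat.
  by near: n; exact: nbhs_infty_gtr.
rewrite /davg /iavg lebesgue_measure_ball ?(ltW Nm0)//.
rewrite [X in (_ * X)%E](_ : _ = (\int[mu]_t (\1_B t * `|q x - q t|))%:E); last first.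
  rewrite -Rintegral_fin// [LHS]integral_mkcond; apply: eq_integral => t _.
  rewrite patchE indicE -/B; case: ifPn => tB; rewrite ?mul1r ?mul0r//=.
  by rewrite distrC.
set I := \int[mu]_t (\1_B t * `|q x - q t|).
rewrite inver ifF; last first.
  by apply/negbTE; rewrite mulrn_eq0 negb_or/= gt_eqF.
rewrite -EFinM lte_fin ltr_pdivrMl ?mulrn_wgt0// => /ltW HI.
apply: (@le_trans _ _ (m * (N / m *+ 2 * d))); first by rewrite ler_wpM2l// ltW.
rewrite le_eqVlt; apply/orP; left; apply/eqP; rewrite /d -mulr_natr; field.
by rewrite !gt_eqF.
Unshelve. all: by end_near. Qed.

Lemma heat_cvg_ae q (M : R) : L1 q -> (forall t, `|q t| <= M) ->
  {ae mu, forall x, (fun n => heat (n.+1%:R ^+ 2) q x) @ \oo --> q x}.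
Proof.
move=> lq qM.
have : {ae mu, forall x, lebesgue_pt q x}.
  by apply: lebesgue_differentiation; apply: open_integrable_locally => //; exact: openT.
by apply: aeS => x; exact: heat_cvg_lebesgue_pt.
Qed.

End ApproximateIdentity.

(** * Vanishing of the Hermite residuals *)

Section Parseval.
Context {R : realType}.
Implicit Types f g u v w q : R -> R.
Local Notation mu := (@lebesgue_measure R).
Local Notation h := (@hermite_fun R).
Local Notation residual n f := (fun x => f x - projsum h n f x).

Lemma sqint_hermite_residual n f : sqint f -> sqint (residual n f).
Proof. exact: (sqint_residual (@sqint_hermite_fun R)). Qed.

Lemma L1_residual_gauss n f : sqint f -> L1 (fun t => residual n f t * gauss 1 t).
Proof.
move=> lf; apply: sqintM; first exact: sqint_hermite_residual.
exact/gdecay_sqint/gdecay_gauss.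
Qed.

Lemma hartley_residual_gauss n f xi :
  hartley (fun t => residual n f t * gauss 1 t) xi = ip (residual n f) (gauss_cas xi).
Proof. by apply: eq_Rintegral => t _; rewrite /gauss_cas mulrA. Qed.

Lemma cvg0_sqr (u : nat -> R) : (fun n => u n ^+ 2) @ \oo --> 0 -> u @ \oo --> 0.
Proof.
move=> u2; apply/cvgr0Pnorm_le => e e0.
have e2 : 0 < e ^+ 2 by rewrite exprn_gt0.
move/cvgr0Pnorm_le : u2 => /(_ _ e2) [N _ HN]; exists N => // n Nn.
have := HN n Nn; rewrite /= normrX ler_pXn2r// ?nnegrE// ltW//.
Qed.

(** [ip_residualC] puts the residual on [gauss_cas xi], where it tends to 0 in norm; Cauchy-Schwarz
    concludes. *)
Lemma ip_residual_gauss_cas_cvg0 f xi : sqint f ->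
  (fun n => ip (residual n f) (gauss_cas xi)) @ \oo --> 0.
Proof.
move=> lf; apply: cvg0_sqr.
have lg := sqint_gauss_cas xi.
apply: (@squeeze_cvgr _ _ _ _ (fun=> 0) (fun n => ip f f *
   ip (residual n (gauss_cas xi)) (residual n (gauss_cas xi)))).
- apply: nearW => n; rewrite sqr_ge0/=.
  rewrite (ip_residualC (@sqint_hermite_fun R))//.
  by apply: ip_cauchy_schwarz => //; exact: sqint_hermite_residual.
- exact: cvg_cst.
- rewrite -[X in _ --> X](mulr0 (ip f f)); apply: cvgM; first exact: cvg_cst.
  exact: gauss_cas_residual_cvg0.
Qed.

Lemma ip_residual_smooth_cvg0 f q (b : R) : 0 < b -> sqint f -> L1 q ->
  (fun n => ip (residual n f) (fun t => gauss 1 t * heat b q t)) @ \oo --> 0.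
Proof.
move=> b0 lf lq; have a0 : 0 < b^-1 by rewrite invr_gt0.
pose w xi := hartley q xi * gauss b^-1 xi.
have lw : L1 w by exact: L1_hartley_gauss.
(* Cauchy-Schwarz bounds the square of the pairing, and |x| <= 1 + x^2 removes the square. *)
pose B := 1 + ip f f * (Num.sqrt 2)^-1.
have HB n xi : `|ip (residual n f) (gauss_cas xi)| <= B.
  have lr := sqint_hermite_residual n lf.
  have := ip_cauchy_schwarz lr (sqint_gauss_cas xi).
  rewrite ip_gauss_cas => H1.
  have H2 : ip (residual n f) (residual n f) * (Num.sqrt 2)^-1 <= ip f f * (Num.sqrt 2)^-1.
    rewrite ler_wpM2r ?invr_ge0//.
    exact: (residual_le (@sqint_hermite_fun R) hermite_orthonormal).
  have {H1 H2} := le_trans H1 H2.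
  rewrite -(real_normK (num_real (ip _ _))) /B.
  have := normr_ge0 (ip (residual n f) (gauss_cas xi)); nra.
have E n : ip (residual n f) (fun t => gauss 1 t * heat b q t) =
    \int[mu]_xi (ip (residual n f) (gauss_cas xi) * w xi).
  (* The heat regularisation is itself the Hartley transform of w, so self-adjointness applies. *)
  transitivity (\int[mu]_t ((residual n f t * gauss 1 t) * hartley w t)).
    apply: eq_Rintegral => t _.
    by rewrite mulrA hartley_gauss_hartley// invrK.
  rewrite -hartley_selfadjoint//; last exact: L1_residual_gauss.
  by apply: eq_Rintegral => xi _; rewrite hartley_residual_gauss.
under eq_fun do rewrite E.
have mh n : measurable_fun [set: R] (fun xi => ip (residual n f) (gauss_cas xi)).
  rewrite [X in measurable_fun _ X](_ : _ = hartley (fun t => residual n f t * gauss 1 t)).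
    exact: measurable_hartley (L1_residual_gauss n lf).
  by apply/funext => xi; rewrite hartley_residual_gauss.
have := @Rintegral_cvg R (fun n xi => ip (residual n f) (gauss_cas xi) * w xi)
  (fun=> 0) (fun xi => B * `|w xi|).
rewrite (_ : \int[mu]_x 0 = 0); last by rewrite Rintegral_cst//= mul0r.
apply => //.
- by move=> n; apply: measurable_funM => //; exact: L1_measurable.
- apply: aeW => xi; rewrite -[X in _ --> X](mul0r (w xi)).
  by apply: cvgM; [exact: ip_residual_gauss_cas_cvg0|exact: cvg_cst].
- exact/L1Z/L1_norm.
- by move=> n xi; rewrite normrM ler_wpM2r.
Qed.

Lemma sqint_cvg0 (F : nat -> R -> R) g :
  (forall n, measurable_fun [set: R] (F n)) ->
  {ae mu, forall x, F ^~ x @ \oo --> (0 : R)} ->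
  sqint g -> (forall n x, `|F n x| <= `|g x|) ->
  (fun n => ip (F n) (F n)) @ \oo --> 0.
Proof.
move=> mF F0 [mg lg] Fg.
have := @Rintegral_cvg R (fun n x => F n x * F n x) (fun=> 0) (fun x => g x ^+ 2).
rewrite (_ : \int[mu]_x 0 = 0); last by rewrite Rintegral_cst//= mul0r.
apply => //.
- by move=> n; exact: measurable_funM.
- apply: aeS F0 => x Fx; rewrite -[X in _ --> X](mulr0 0); exact: cvgM.
- move=> n x; rewrite -(real_normK (num_real (g x))) normrM expr2.
  by apply: ler_pM.
Qed.

(** Both the argument and the value are cut, so that the truncation divided by a Gaussian is still
    bounded and supported in a bounded interval. *)
Definition truncation (n : nat) f : R -> R :=
  fun x => ((`|x| <= n%:R) && (`|f x| <= n%:R))%:R * f x.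

Lemma measurable_truncation n f : measurable_fun [set: R] f ->
  measurable_fun [set: R] (truncation n f).
Proof.
move=> mf; apply: measurable_funM => //.
pose A : set R := [set x | `|x| <= n%:R] `&` [set x | `|f x| <= n%:R].
rewrite [X in measurable_fun _ X](_ : _ = \1_A); last first.
  apply/funext => x; rewrite indicE; congr (nat_of_bool _)%:R.
  by apply/idP/idP; rewrite inE /A/=; [move/andP|move=> /andP].
apply: measurable_indic; apply: measurableI.
  rewrite -[X in measurable X]setTI.
  apply: measurable_fun_le => //; exact: measurableT_comp.
rewrite -[X in measurable X]setTI.
by apply: measurable_fun_le => //; exact: measurableT_comp.
Qed.

Lemma truncation_cvg f : sqint f ->
  (fun n => ip (fun x => f x - truncation n f x) (fun x => f x - truncation n f x))
    @ \oo --> 0.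
Proof.
move=> lf; have [mf _] := lf; apply: (@sqint_cvg0 _ f) => //.
- by move=> n; apply: measurable_funB => //; exact: measurable_truncation.
- apply: aeW => x; apply: cvg_near_cst; near=> n.
  rewrite /truncation (_ : (_ && _) = true) ?mul1r ?subrr//.
  by apply/andP; split; near: n; exact: nbhs_infty_ger.
- move=> n x; rewrite /truncation; case: (_ && _); rewrite ?mul1r ?subrr ?normr0//.
  by rewrite mul0r subr0.
Unshelve. all: by end_near. Qed.

(* The approximant is G times a heat regularisation of (truncated f) / G, where
   G = gauss 1: by ip_residual_smooth_cvg0 the residuals vanish against it. *)
Lemma smooth_approximation f (e : R) : sqint f -> 0 < e ->
  exists v, [/\ sqint v, ip (fun x => f x - v x) (fun x => f x - v x) <= e &
    forall u, sqint u -> (fun n => ip (residual n u) v) @ \oo --> 0].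
Proof.
move=> lf e0; have [mf _] := lf.
have e4 : 0 < e / 4 by rewrite divr_gt0.
have /cvgr0Pnorm_le/(_ _ e4)[N _ /(_ N (leqnn N))] := truncation_cvg lf.
set f1 := truncation N f => /= H1.
have mf1 : measurable_fun [set: R] f1 by exact: measurable_truncation.
have lf1 : sqint f1.
  apply: sqint_le mf1 _ lf => x; rewrite /f1 /truncation normrM ler_piMl//.
  by case: (_ && _); rewrite ?normr1 ?normr0.
pose q x := (gauss 1 x)^-1 * f1 x.
(* On [-N, N] the reciprocal Gaussian is at most exp(pi N^2), and the truncation is at most N. *)
pose M : R := expR (pi * 1 * N%:R ^+ 2) * N%:R.
have qI x : `|q x| <= M * \1_(`[- N%:R, N%:R]%classic) x.
  rewrite /q /f1 /truncation indicE mem_setE in_itv/= -ler_norml.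
  case: (leP `|x| N%:R) => xN /=; last by rewrite mul0r mulr0 normr0 mulr0.
  rewrite mulr1; case: (leP `|f x| N%:R) => fN /=; last first.
    by rewrite mul0r mulr0 normr0 mulr_ge0// expR_ge0.
  rewrite mul1r normrM ler_pM// /gauss expRN invrK ger0_norm ?expR_ge0//.
  rewrite ler_expR ler_wpM2l ?mulr1 ?pi_ge0//.
  by rewrite -(real_normK (num_real x)) lerXn2r ?nnegrE.
have M0 : 0 <= M by rewrite mulr_ge0// expR_ge0.
have qM x : `|q x| <= M.
  by rewrite (le_trans (qI x))// ler_piMr// indicE; case: (_ \in _).
have mq : measurable_fun [set: R] q.
  apply: measurable_funM => //; rewrite [X in measurable_fun _ X](_ : _ = gauss (- 1)).
    exact: measurable_gauss.
  by apply/funext => x; rewrite /gauss -expRN; congr expR; ring.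
have lq : L1 q.
  apply: (L1_le mq qI); apply: L1Z.
  exact: (@integrable_indic_itv R (- N%:R) N%:R true false).
have lg : sqint (gauss 1 : R -> R) by exact/gdecay_sqint/gdecay_gauss.
have b0 n : 0 < (n.+1%:R : R) ^+ 2 by rewrite exprn_gt0.
have mh n : measurable_fun [set: R] (heat (n.+1%:R ^+ 2) q).
  have a0 : 0 < ((n.+1%:R : R) ^+ 2)^-1 by rewrite invr_gt0.
  rewrite (_ : heat _ _ = hartley (fun xi => hartley q xi * gauss (n.+1%:R ^+ 2)^-1 xi)).
    exact: measurable_hartley (L1_hartley_gauss a0 lq).
  by apply/funext => x; rewrite hartley_gauss_hartley// invrK.
pose F n x := gauss 1 x * (q x - heat (n.+1%:R ^+ 2) q x).
have : (fun n => ip (F n) (F n)) @ \oo --> 0.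
  apply: (@sqint_cvg0 _ (fun x => (2 * M) * gauss 1 x)).
  - by move=> n; apply: measurable_funM; [exact: measurable_gauss|exact: measurable_funB].
  - apply: aeS (heat_cvg_ae lq qM) => x Hx; rewrite -[X in _ --> X](mulr0 (gauss 1 x)).
    apply: cvgM; first exact: cvg_cst.
    by rewrite -(subrr (q x)); apply: cvgB => //; exact: cvg_cst.
  - exact: sqintZ.
  - move=> n x; rewrite [in leRHS]mulrC !(normrM (gauss 1 x)) ler_wpM2l//.
    rewrite (le_trans (ler_normB _ _))// ger0_norm ?mulr_ge0// mulr_natl mulr2n.
    by rewrite lerD ?heat_bounded.
move=> /cvgr0Pnorm_le/(_ _ e4)[n _ /(_ n (leqnn n))] /= H2.
pose v x := gauss 1 x * heat (n.+1%:R ^+ 2) q x.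
have lv : sqint v.
  apply: (@eq_sqint _ (fun x => heat (n.+1%:R ^+ 2) q x * gauss 1 x)) => [x|].
    by rewrite /v mulrC.
  by apply: (sqintM_bounded (mh n)) lg => x; exact: heat_bounded.
exists v; split => //; last by move=> u lu; exact: ip_residual_smooth_cvg0.
pose A x := f x - f1 x.
have lA : sqint A by exact: sqintB.
have lB : sqint (F n).
  apply: (@eq_sqint _ (fun x => f1 x - v x)) => [x|]; last exact: sqintB.
  by rewrite /F mulrBr /q mulVKf// gt_eqF// gauss_gt0.
rewrite (_ : (fun x => f x - v x) = (fun x => A x + F n x)); last first.
  apply/funext => x; rewrite /A /F mulrBr /q mulVKf ?gt_eqF ?gauss_gt0// -/(v x); ring.
(* Nonnegativity for the difference bounds the squared norm of A + F n by twice the sum of the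
   squared norms, each at most e / 4. *)
have := ip_ge0 (fun x => A x - F n x).
rewrite (ipBl lA lB (sqintB lA lB)) (ipBr lA lA lB) (ipBr lB lA lB).
rewrite (ipDl lA lB (sqintD lA lB)) (ipDr lA lA lB) (ipDr lB lA lB).
move: H1 H2; rewrite !ger0_norm ?ip_ge0// (ipC (F n) A).
rewrite -/A; move: (ip A A) (ip A (F n)) (ip (F n) (F n)) => x y z; lra.
Qed.

(** By orthogonality the squared norm of the residual is its pairing with f. Splitting f as v + (f -
    v), the first pairing vanishes asymptotically and the second is small by Cauchy-Schwarz,
    uniformly in n. *)
Lemma hermite_residual_cvg0 f : sqint f ->
  (fun n => ip (residual n f) (residual n f)) @ \oo --> 0.
Proof.
move=> lf; apply/cvgr0Pnorm_le => e e0.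
have f0 := ip_ge0 f.
(* Chosen so that (1 + [ip f f]) d = (e / 2)^2; the added 1 avoids a division by 0. *)
pose d := (e / 2) ^+ 2 / (1 + ip f f).
have d0 : 0 < d.
  by rewrite divr_gt0 ?exprn_gt0 ?divr_gt0// (lt_le_trans ltr01)// lerDl.
have [v [lv fv rv]] := smooth_approximation lf d0.
have e2 : 0 < e / 2 by rewrite divr_gt0.
have /cvgr0Pnorm_le/(_ _ e2)[N _ HN] := rv f lf.
exists N => // n Nn; have /= {}HN := HN n Nn.
have lr := sqint_hermite_residual n lf.
have E : ip (residual n f) (residual n f) =
    ip (residual n f) v + ip (residual n f) (fun x => f x - v x).
  rewrite [X in _ = _ + X]ipBr// [RHS]addrC subrK.
  rewrite (ip_residual_residual (@sqint_hermite_fun R) hermite_orthonormal)//.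
  by rewrite (ip_residual (@sqint_hermite_fun R)).
rewrite /= E (le_trans (ler_normD _ _))// [e]splitr lerD//.
rewrite -(@ler_pXn2r _ 2)// ?nnegrE// ?(ltW e2)// real_normK ?num_real//.
apply: (le_trans (ip_cauchy_schwarz lr (sqintB lf lv))).
apply: (@le_trans _ _ ((1 + ip f f) * d)).
  apply: ler_pM => //; try exact: ip_ge0.
  rewrite (le_trans (residual_le (@sqint_hermite_fun R) hermite_orthonormal n lf))//.
  by rewrite lerDr.
by rewrite mulrC divfK// gt_eqF// (lt_le_trans ltr01)// lerDl.
Qed.

Lemma hermite_parseval f : sqint f ->
  (fun n => \sum_(i < n) ip f (h i) ^+ 2) @ \oo --> ip f f.
Proof.
move=> lf; have := hermite_residual_cvg0 lf.
rewrite (_ : (fun n => ip _ _) = (fun n => ip f f - \sum_(i < n) ip f (h i) ^+ 2)); last first.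
  apply/funext => n.
  by rewrite (ip_residual_residual (@sqint_hermite_fun R) hermite_orthonormal).
move=> H; rewrite -[X in _ --> X]subr0.
rewrite (_ : (fun n => \sum_(i < n) _) =
  (fun n => ip f f - (ip f f - \sum_(i < n) ip f (h i) ^+ 2))); last first.
  by apply/funext => n; rewrite subKr.
by apply: cvgB => //; exact: cvg_cst.
Qed.

End Parseval.

(** * Lower bound for the energy *)

Section Energy.
Context {R : realType}.
Implicit Types f g u v w q : R -> R.
Local Notation mu := (@lebesgue_measure R).
Local Notation h := (@hermite_fun R).
Local Notation s := (@sqrt_pi R).
Local Notation a := (@sqrt_nat R).

(** Spectrum of the harmonic oscillator in this normalisation: time and frequency each contribute
    (2k+1)/(4 pi). *)
Definition hermite_eigenvalue (k : nat) : R := (2 * k%:R + 1) / (2 * pi).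
Local Notation lam := hermite_eigenvalue.

Lemma ip_mulX g k : sqint g -> sqint (fun t => t * g t) ->
  2 * s * ip (fun t => t * g t) (h k) =
  a k.+1 * ip g (h k.+1) + a k * ip g (h k.-1).
Proof.
move=> lg ltg; have lh := @sqint_hermite_fun R.
have lth : sqint (fun t => t * h k t) by exact/gdecay_sqint/gdecayXM/gdecay_hermite_fun.
rewrite (_ : ip _ (h k) = ip g (fun t => t * h k t)); last first.
  by apply: eq_Rintegral => t _; ring.
rewrite -(ipZr (2 * s) lg lth) -(ipZr (a k.+1) lg (lh _)) -(ipZr (a k) lg (lh _)).
rewrite -(ipDr lg (sqintZ _ (lh _)) (sqintZ _ (lh _))).
by apply: eq_ip => // t; exact: hermite_fun_recurrence.
Qed.

Lemma ip_hartley_hermite u k : L1 u -> ip (hartley u) (h k) = hartley_sign k * ip u (h k).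
Proof.
move=> lu; rewrite /ip hartley_selfadjoint//; last exact: L1_hermite_fun.
have lc : L1 (fun t => u t * h k t).
  apply: (@eq_L1 _ (fun t => h k t * u t)) => [t|]; first by rewrite mulrC.
  have gh : gdecay (h k) by exact: gdecay_hermite_fun.
  have [C HC] := gdecay_bounded gh.
  exact: (L1M_bounded (gdecay_measurable gh) HC lu).
rewrite -RintegralZl//; apply: eq_Rintegral => t _.
by rewrite hartley_hermite mulrCA.
Qed.

(** x_i is reached from i - 1 with coefficient i and from i + 1 with coefficient i + 1. The last two
    terms are the indices that the cut at J leaves with one neighbour. *)
Lemma three_term_sum (x : nat -> R) J :
  \sum_(j < J.+1) (j.+1%:R * x j.+1 + j%:R * x j.-1) =
  \sum_(j < J) (2 * j%:R + 1) * x j + J%:R * x J + J.+1%:R * x J.+1.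
Proof.
elim: J => [|J IH]; first by rewrite big_ord1 big_ord0/=; ring.
by rewrite big_ord_recr IH big_ord_recr /= -!natr1; ring.
Qed.

(** The coefficients of t u and of xi (Hu) combine the same two neighbours of j, once with equal and
    once with opposite relative sign, up to a global sign. In the sum of their squares the cross
    terms cancel. *)
Lemma energy_ge u J : L1 u -> sqint u -> sqint (fun t => t * u t) ->
  sqint (fun xi => xi * hartley u xi) ->
  \sum_(j < J) lam j * ip u (h j) ^+ 2 <=
  ip (fun t => t * u t) (fun t => t * u t) +
  ip (fun xi => xi * hartley u xi) (fun xi => xi * hartley u xi).
Proof.
move=> lu l2u ltu lxu.
have [lHu _] := hartley_plancherel_le lu l2u.
have lh := @sqint_hermite_fun R.
(* One coefficient more than in the target sum: a mode j < J collects from the coefficients j - 1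
   and j + 1. *)
have B1 := bessel lh hermite_orthonormal J.+1 ltu.
have B2 := bessel lh hermite_orthonormal J.+1 lxu.
apply: le_trans (lerD B1 B2); rewrite -big_split /=.
set x := fun j => ip u (h j) ^+ 2.
have p0 : 0 < 2 * pi :> R by rewrite mulr_gt0// pi_gt0.
rewrite -(ler_pM2l p0) [leRHS]mulr_sumr.
rewrite [leRHS](_ : _ = \sum_(j < J.+1) (j.+1%:R * x j.+1 + j%:R * x j.-1)); last first.
  apply: eq_bigr => -[j /= _] _.
  have E1 := ip_mulX j l2u ltu; have E2 := ip_mulX j lHu lxu.
  rewrite !ip_hartley_hermite// in E2.
  (* Signs two indices apart are opposite; this is what flips the relative sign. For j = 0 both
     sides vanish. *)
  have e2 : a j * hartley_sign j.-1 = - (a j * hartley_sign j.+1).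
    case: j {E1 E2} => [|j]; first by rewrite sqrt_nat0 !mul0r oppr0.
    rewrite /= !hartley_signS exprS -mulrN; congr (_ * _).
    rewrite mulrA -[X in _ = - (X * _)]mulrA -expr2 -exprM mulnC exprM sqrrN !expr1n.
    by rewrite mulr1 mulN1r opprK.
  have E2' : 2 * s * ip (fun t => t * hartley u t) (h j) =
      hartley_sign j.+1 * (a j.+1 * ip u (h j.+1) - a j * ip u (h j.-1)).
    rewrite E2 mulrDr mulrCA; congr (_ + _).
    by rewrite mulrA e2; ring.
  have s4 : 2 * pi = 2^-1 * (2 * s) ^+ 2 by rewrite sqr_sqrt_pi; field.
  rewrite s4 -mulrA mulrDr -!exprMn E1 E2' exprMn hartley_sign_sqr mul1r /x.
  rewrite -[j.+1%:R]sqr_sqrt_nat -[in RHS](sqr_sqrt_nat j); by field.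
rewrite (three_term_sum x J) mulr_sumr -addrA.
rewrite [leLHS](_ : _ = \sum_(j < J) (2 * j%:R + 1) * x j).
  by rewrite lerDl addr_ge0// mulr_ge0// sqr_ge0.
apply: eq_bigr => j _; rewrite /hermite_eigenvalue -/(x j) mulrA; congr (_ * _).
by rewrite mulrC divfK// gt_eqF.
Qed.

End Energy.

(** * The Fourier transform on L2 *)

Section ComplexFourier.
Context {R : realType}.
Implicit Types f g : R -> R[i].
Local Notation mu := (@lebesgue_measure R).

Definition re_fun f (t : R) : R := complex.Re (f t).
Definition im_fun f (t : R) : R := complex.Im (f t).

Definition sqnorm f : \bar R :=
  (\int[mu]_t (re_fun f t ^+ 2 + im_fun f t ^+ 2)%:E)%E.

Lemma modulus_sqr (z : R[i]) : modulus z ^+ 2 = complex.Re z ^+ 2 + complex.Im z ^+ 2.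
Proof. by case: z => x y; rewrite /modulus /= sqr_sqrtr// addr_ge0 ?sqr_ge0. Qed.

Lemma modulus_ge0 (z : R[i]) : 0 <= modulus z.
Proof. by case: z => x y; rewrite /modulus /= sqrtr_ge0. Qed.

Lemma normr_Re_le (z : R[i]) : `|complex.Re z| <= modulus z.
Proof.
rewrite -(@ler_pXn2r _ 2)// ?nnegrE ?modulus_ge0// modulus_sqr.
by rewrite real_normK ?num_real// lerDl sqr_ge0.
Qed.

Lemma normr_Im_le (z : R[i]) : `|complex.Im z| <= modulus z.
Proof.
rewrite -(@ler_pXn2r _ 2)// ?nnegrE ?modulus_ge0// modulus_sqr.
by rewrite real_normK ?num_real// lerDr sqr_ge0.
Qed.

Lemma modulus_le (z : R[i]) : modulus z <= `|complex.Re z| + `|complex.Im z|.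
Proof.
rewrite -(@ler_pXn2r _ 2)// ?nnegrE ?modulus_ge0 ?addr_ge0// modulus_sqr sqrrD.
rewrite !real_normK ?num_real// addrAC lerDl mulrn_wge0// mulr_ge0//.
Qed.

Lemma cLnorm2_sqnorm f : (cLnorm 2%:E f `^ 2 = sqnorm f)%E.
Proof.
rewrite poweR_Lnorm//; apply: eq_integral => t _ /=.
by rewrite ger0_norm ?modulus_ge0// powR_mulrn ?modulus_ge0// modulus_sqr.
Qed.

Lemma cmeasurable_modulus f : cmeasurable f ->
  measurable_fun [set: R] (fun t => modulus (f t)).
Proof.
move=> [mr mi]; rewrite [X in measurable_fun _ X](_ : _ =
    fun t => Num.sqrt (complex.Re (f t) ^+ 2 + complex.Im (f t) ^+ 2)); last first.
  by apply/funext => t; rewrite /modulus; case: (f t).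
apply: (@measurableT_comp _ _ _ _ _ _ (@Num.sqrt R)).
  by apply: continuous_measurable_fun; exact: sqrt_continuous.
by apply: measurable_funD; exact: measurable_funX.
Qed.

Lemma sqnorm_fin f : sqint (re_fun f) -> sqint (im_fun f) ->
  sqnorm f = (ip (re_fun f) (re_fun f) + ip (im_fun f) (im_fun f))%:E.
Proof.
move=> lr li; rewrite /sqnorm.
under eq_integral do rewrite EFinD.
rewrite ge0_integralD//.
- by rewrite !ip_fin.
- by move=> x _; rewrite lee_fin sqr_ge0.
- by apply/measurable_EFinP/measurable_funX; case: lr.
- by move=> x _; rewrite lee_fin sqr_ge0.
- by apply/measurable_EFinP/measurable_funX; case: li.
Qed.

Lemma sqnorm_lty f : cmeasurable f -> (sqnorm f < +oo)%E ->
  sqint (re_fun f) /\ sqint (im_fun f).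
Proof.
move=> [mr mi] foo.
by split; apply: sqint_ip_lty => //; apply: le_lt_trans foo;
  apply: ge0_le_integral => //; do ?[by move=> x _; rewrite lee_fin ?addr_ge0 ?sqr_ge0
   | by apply/measurable_EFinP; apply: measurable_funX
   | by apply/measurable_EFinP; apply: measurable_funD; exact: measurable_funX];
  move=> x _; rewrite lee_fin ?lerDl ?lerDr sqr_ge0.
Qed.

Lemma in_Lp2P f : in_Lp 2%:E f <-> sqint (re_fun f) /\ sqint (im_fun f).
Proof.
split=> [[mf foo]|[lr li]].
  apply: sqnorm_lty => //; rewrite -cLnorm2_sqnorm.
  exact: poweR_lty.
split; first by split; [case: lr|case: li].
rewrite /cLnorm unlock; apply: poweR_lty.
have := cLnorm2_sqnorm f; rewrite poweR_Lnorm// => ->.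
by rewrite sqnorm_fin// ltry.
Qed.

Lemma in_Lp1P f : in_Lp 1%:E f <-> L1 (re_fun f) /\ L1 (im_fun f).
Proof.
split=> [[mf foo]|[lr li]].
  have lm : L1 (fun t => modulus (f t)).
    apply/integrableP; split.
      by apply/measurable_EFinP; exact: cmeasurable_modulus.
    by move: foo; rewrite /cLnorm Lnorm1.
  by case: mf => mr mi; split; apply: L1_le lm => // t;
    [exact: normr_Re_le|exact: normr_Im_le].
have mf : cmeasurable f by split; exact: L1_measurable.
split => //; rewrite /cLnorm Lnorm1.
have : L1 (fun t => modulus (f t)).
  apply: L1_le (L1D (L1_norm lr) (L1_norm li)); first exact: cmeasurable_modulus.
  by move=> t; rewrite ger0_norm ?modulus_ge0// modulus_le.
by case/integrableP.
Qed.

Lemma cLnorm_cvg0_sqnorm (F : nat -> R -> R[i]) (e : R) : 0 < e ->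
  (fun m => cLnorm 2%:E (F m)) @ \oo --> 0%E ->
  \forall m \near \oo, (sqnorm (F m) <= e%:E)%E.
Proof.
move=> e0 F0; have d0 : 0 < Num.sqrt e by rewrite sqrtr_gt0.
have : \forall m \near \oo, (cLnorm 2%:E (F m) < (Num.sqrt e)%:E)%E.
  apply: (F0 [set y | (y < (Num.sqrt e)%:E)%E]); apply: open_nbhs_nbhs.
  by split; [exact: open_ereal_lt_ereal|rewrite /= lte_fin].
apply: filterS => m; rewrite -cLnorm2_sqnorm.
have := Lnorm_ge0 mu 2%:E (fun x => (modulus (F m x))%:E); rewrite -/(cLnorm 2%:E (F m)).
case: (cLnorm _ _) => [r| |]//; rewrite lee_fin lte_fin => r0 /ltW re.
rewrite poweR_EFin lee_fin powR_mulrn// -(sqr_sqrtr (ltW e0)).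
by rewrite lerXn2r ?nnegrE.
Qed.

(** * Fourier integrals in terms of Hartley transforms *)

Section FourierIntegral.
Variable f : R -> R[i].
Hypothesis lu : L1 (re_fun f).
Hypothesis lv : L1 (im_fun f).
Local Notation U := (hartley (re_fun f)).
Local Notation V := (hartley (im_fun f)).

(** The even and odd parts of cas are cos and sin, so symmetrising U gives the cosine integral of
    the real part and antisymmetrising V the sine integral of the imaginary part. *)
Lemma Re_fourier_integral xi : re_fun (fourier_integral f) xi =
  2^-1 * ((U xi + U (- xi)) + (V xi - V (- xi))).
Proof.
have lU x := L1_cas x lu; have lV x := L1_cas x lv.
have l1 := L1D (lU xi) (lU (- xi)); have l2 := L1B (lV xi) (lV (- xi)).
transitivity (\int[mu]_t (2^-1 * ((re_fun f t * cas (2 * pi * t * xi) + re_fun f t * cas (2 * pi * t * - xi)) +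
    (im_fun f t * cas (2 * pi * t * xi) - im_fun f t * cas (2 * pi * t * - xi))))); last first.
  rewrite RintegralZl//; last exact: (L1D l1 l2).
  rewrite RintegralD// RintegralD//; last 2 first; try exact: (lU _).
  by rewrite RintegralB//; exact: (lV _).
rewrite /re_fun /im_fun /fourier_integral /cintegral /=.
apply: eq_Rintegral => t _.
rewrite mulrN /cas !cosN !sinN /expi; case: (f t) => x y /=.
by rewrite cosN sinN; field.
Qed.

Lemma Im_fourier_integral xi : im_fun (fourier_integral f) xi =
  2^-1 * ((V xi + V (- xi)) - (U xi - U (- xi))).
Proof.
have lU x := L1_cas x lu; have lV x := L1_cas x lv.
have l1 := L1D (lV xi) (lV (- xi)); have l2 := L1B (lU xi) (lU (- xi)).
transitivity (\int[mu]_t (2^-1 * ((im_fun f t * cas (2 * pi * t * xi) + im_fun f t * cas (2 * pi * t * - xi)) -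
    (re_fun f t * cas (2 * pi * t * xi) - re_fun f t * cas (2 * pi * t * - xi))))); last first.
  rewrite RintegralZl//; last exact: (L1B l1 l2).
  rewrite RintegralB// RintegralD//; last 2 first; try exact: (lV _).
  by rewrite RintegralB//; exact: (lU _).
rewrite /re_fun /im_fun /fourier_integral /cintegral /=.
apply: eq_Rintegral => t _.
rewrite mulrN /cas !cosN !sinN /expi; case: (f t) => x y /=.
by rewrite cosN sinN; field.
Qed.

Lemma measurable_Re_fourier_integral :
  measurable_fun [set: R] (re_fun (fourier_integral f)).
Proof.
have mU := measurable_hartley lu; have mV := measurable_hartley lv.
rewrite [X in measurable_fun _ X](_ : _ = fun xi =>
  2^-1 * ((U xi + U (- xi)) + (V xi - V (- xi)))); last first.
  by apply/funext => xi; rewrite Re_fourier_integral.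
apply: measurable_funM => //; apply: measurable_funD.
  by apply: measurable_funD => //; exact: measurableT_comp.
by apply: measurable_funB => //; exact: measurableT_comp.
Qed.

Lemma measurable_Im_fourier_integral :
  measurable_fun [set: R] (im_fun (fourier_integral f)).
Proof.
have mU := measurable_hartley lu; have mV := measurable_hartley lv.
rewrite [X in measurable_fun _ X](_ : _ = fun xi =>
  2^-1 * ((V xi + V (- xi)) - (U xi - U (- xi)))); last first.
  by apply/funext => xi; rewrite Im_fourier_integral.
apply: measurable_funM => //; apply: measurable_funB.
  by apply: measurable_funD => //; exact: measurableT_comp.
by apply: measurable_funB => //; exact: measurableT_comp.
Qed.

(* Symmetrising in xi removes the cross terms between the even and odd parts. *)
Lemma fourier_integral_even_weight (w : R -> R) : measurable_fun [set: R] w ->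
  (forall xi, 0 <= w xi) -> (forall xi, w (- xi) = w xi) ->
  (\int[mu]_xi (w xi * (re_fun (fourier_integral f) xi ^+ 2 +
     im_fun (fourier_integral f) xi ^+ 2))%:E =
   \int[mu]_xi (w xi * (U xi ^+ 2 + V xi ^+ 2))%:E)%E.
Proof.
move=> mw w0 wN.
set A := fun xi => w xi * (re_fun (fourier_integral f) xi ^+ 2 +
     im_fun (fourier_integral f) xi ^+ 2).
set B := fun xi => w xi * (U xi ^+ 2 + V xi ^+ 2).
have mA : measurable_fun [set: R] A.
  apply: measurable_funM => //; apply: measurable_funD; apply: measurable_funX.
    exact: measurable_Re_fourier_integral.
  exact: measurable_Im_fourier_integral.
have mB : measurable_fun [set: R] B.
  apply: measurable_funM => //; apply: measurable_funD; apply: measurable_funX;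
    exact: measurable_hartley.
have A0 xi : 0 <= A xi by rewrite mulr_ge0// addr_ge0 ?sqr_ge0.
have B0 xi : 0 <= B xi by rewrite mulr_ge0// addr_ge0 ?sqr_ge0.
have E xi : A xi + A (- xi) = B xi + B (- xi).
  by rewrite /A /B wN !Re_fourier_integral !Im_fourier_integral opprK; field.
have dbl (F : R -> R) : measurable_fun [set: R] F -> (forall x, 0 <= F x) ->
    (\int[mu]_x (F x)%:E + \int[mu]_x (F x)%:E = \int[mu]_x (F x + F (- x))%:E)%E.
  move=> mF F0; rewrite -[X in (_ + X)%E](@ge0_integral_opp R (EFin \o F)).
  - rewrite -ge0_integralD//.
    + by move=> x _; rewrite lee_fin.
    + exact/measurable_EFinP.
    + by move=> x _; rewrite lee_fin.
    + by apply/measurable_EFinP; apply: measurableT_comp.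
  - exact/measurable_EFinP.
  - by move=> x; rewrite lee_fin.
have E' : (\int[mu]_x (A x + A (- x))%:E = \int[mu]_x (B x + B (- x))%:E)%E.
  by apply: eq_integral => x _; congr EFin; exact: E.
have := dbl A mA A0; rewrite E' -(dbl B mB B0).
have : (0 <= \int[mu]_x (A x)%:E)%E by apply: integral_ge0 => x _; rewrite lee_fin.
have : (0 <= \int[mu]_x (B x)%:E)%E by apply: integral_ge0 => x _; rewrite lee_fin.
case: (integral _ _ _) => [b| |]//; case: (integral _ _ _) => [a| |]// _ _ [] ab.
congr EFin; lra.
Qed.

End FourierIntegral.

End ComplexFourier.

(** * Identification of the chosen transform on L1 and L2 *)

Section FourierL2.
Context {R : realType}.
Implicit Types f g : R -> R[i].
Local Notation mu := (@lebesgue_measure R).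

Lemma sqnorm_fourier_integral f : L1 (re_fun f) -> L1 (im_fun f) ->
  sqnorm (fourier_integral f) =
  (\int[mu]_xi (hartley (re_fun f) xi ^+ 2 + hartley (im_fun f) xi ^+ 2)%:E)%E.
Proof.
move=> lu lv.
have := @fourier_integral_even_weight R f lu lv (fun=> 1) (measurable_cst _)
  (fun=> ler01) (fun=> erefl).
under eq_integral do rewrite mul1r.
by under [X in _ = X -> _]eq_integral do rewrite mul1r.
Qed.

Lemma cmeasurable_fourier_integral f : L1 (re_fun f) -> L1 (im_fun f) ->
  cmeasurable (fourier_integral f).
Proof.
move=> lu lv.
by split; [exact: measurable_Re_fourier_integral|exact: measurable_Im_fourier_integral].
Qed.

Lemma fourier_integral_plancherel_le f : in_Lp 1%:E f -> in_Lp 2%:E f ->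
  (sqnorm (fourier_integral f) <= sqnorm f)%E /\ in_Lp 2%:E (fourier_integral f).
Proof.
move=> /in_Lp1P[lu lv] /in_Lp2P[l2u l2v].
have [lHu Hu] := hartley_plancherel_le lu l2u.
have [lHv Hv] := hartley_plancherel_le lv l2v.
have E : sqnorm (fourier_integral f) =
    (ip (hartley (re_fun f)) (hartley (re_fun f)) +
     ip (hartley (im_fun f)) (hartley (im_fun f)))%:E.
  rewrite sqnorm_fourier_integral//.
  exact: (@sqnorm_fin R (fun xi => hartley (re_fun f) xi +i* hartley (im_fun f) xi)).
split; first by rewrite E sqnorm_fin// lee_fin lerD.
apply/in_Lp2P; apply: sqnorm_lty; first exact: cmeasurable_fourier_integral.
by rewrite E ltry.
Qed.

Lemma re_funB f g : re_fun (fun x => f x - g x) = fun x => re_fun f x - re_fun g x.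
Proof. by apply/funext => x; rewrite /re_fun; case: (f x) => a b; case: (g x). Qed.

Lemma im_funB f g : im_fun (fun x => f x - g x) = fun x => im_fun f x - im_fun g x.
Proof. by apply/funext => x; rewrite /im_fun; case: (f x) => a b; case: (g x). Qed.

Lemma in_Lp1B f g : in_Lp 1%:E f -> in_Lp 1%:E g -> in_Lp 1%:E (fun x => f x - g x).
Proof.
move=> /in_Lp1P[fr fi] /in_Lp1P[gr gi]; apply/in_Lp1P.
by rewrite re_funB im_funB; split; exact: L1B.
Qed.

Lemma in_Lp2B f g : in_Lp 2%:E f -> in_Lp 2%:E g -> in_Lp 2%:E (fun x => f x - g x).
Proof.
move=> /in_Lp2P[fr fi] /in_Lp2P[gr gi]; apply/in_Lp2P.
by rewrite re_funB im_funB; split; exact: sqintB.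
Qed.

Lemma re_im_inj (z w : R[i]) : complex.Re z = complex.Re w ->
  complex.Im z = complex.Im w -> z = w.
Proof. by case: z => a b; case: w => c d /= -> ->. Qed.

Lemma fourier_integralB f g : in_Lp 1%:E f -> in_Lp 1%:E g ->
  fourier_integral (fun x => f x - g x) =
  fun xi => fourier_integral f xi - fourier_integral g xi.
Proof.
move=> lf lg; have /in_Lp1P[lr li] := in_Lp1B lf lg.
move: lf lg => /in_Lp1P[fr fi] /in_Lp1P[gr gi].
apply/funext => xi; apply: re_im_inj.
  have E := Re_fourier_integral lr li xi; rewrite !re_funB !im_funB !hartleyB// in E.
  apply: (eq_trans E).
  transitivity (re_fun (fourier_integral f) xi - re_fun (fourier_integral g) xi).
    by rewrite !Re_fourier_integral//; ring.
  by rewrite -[RHS]/(re_fun (fun xi => fourier_integral f xi - fourier_integral g xi) xi)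
    re_funB.
have E := Im_fourier_integral lr li xi; rewrite !re_funB !im_funB !hartleyB// in E.
apply: (eq_trans E).
transitivity (im_fun (fourier_integral f) xi - im_fun (fourier_integral g) xi).
  by rewrite !Im_fourier_integral//; ring.
by rewrite -[RHS]/(im_fun (fun xi => fourier_integral f xi - fourier_integral g xi) xi)
  im_funB.
Qed.

(** The parallelogram inequality replaces the triangle inequality, so that no square root of an
    extended real is handled. *)
Lemma sqnorm_triangle f g k : in_Lp 2%:E f -> in_Lp 2%:E g -> in_Lp 2%:E k ->
  (sqnorm (fun x => f x - g x)%R <=
   2%:E * (sqnorm (fun x => f x - k x)%R + sqnorm (fun x => k x - g x)%R))%E.
Proof.
move=> lf lg lk.
have /in_Lp2P[r1 i1] := in_Lp2B lf lk; have /in_Lp2P[r2 i2] := in_Lp2B lk lg.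
rewrite (sqnorm_fin r1 i1) (sqnorm_fin r2 i2).
have := in_Lp2B lf lg => /in_Lp2P[r3 i3]; rewrite (sqnorm_fin r3 i3).
rewrite -EFinD -EFinM lee_fin.
have key (p q r : R -> R) : sqint p -> sqint q -> (forall x, r x = p x + q x) ->
    ip r r <= 2 * (ip p p + ip q q).
  move=> lp lq /funext ->.
  have := ip_ge0 (fun x => p x - q x).
  rewrite (ipBl lp lq (sqintB lp lq)) (ipBr lp lp lq) (ipBr lq lp lq).
  rewrite (ipDl lp lq (sqintD lp lq)) (ipDr lp lp lq) (ipDr lq lp lq) (ipC q p).
  lra.
have := key _ _ (re_fun (fun x => f x - g x)) r1 r2 _.
have := key _ _ (im_fun (fun x => f x - g x)) i1 i2 _.
rewrite !re_funB !im_funB => H1 H2.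
have {}H1 := H1 (fun x => _); have {}H2 := H2 (fun x => _).
apply: (le_trans (lerD (H2 _) (H1 _))); try by move=> x; ring.
by rewrite -mulrDr ler_wpM2l// addrACA.
Qed.

Lemma sqnorm_eq0_ae f g : in_Lp 2%:E f -> in_Lp 2%:E g ->
  (forall e : R, 0 < e -> (sqnorm (fun x => f x - g x)%R <= e%:E)%E) ->
  {ae mu, forall x, f x = g x}.
Proof.
move=> lf lg H; have /in_Lp2P[r i] := in_Lp2B lf lg.
rewrite (sqnorm_fin r i) in H.
have r0 := ip_ge0 (re_fun (fun x => f x - g x)).
have i0 := ip_ge0 (im_fun (fun x => f x - g x)).
have S0 : ip (re_fun (fun x => f x - g x)) (re_fun (fun x => f x - g x)) +
    ip (im_fun (fun x => f x - g x)) (im_fun (fun x => f x - g x)) <= 0.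
  apply/ler_addgt0Pl => e e0; rewrite addr0.
  by have := H e e0; rewrite lee_fin.
have [rE iE] : ip (re_fun (fun x => f x - g x)) (re_fun (fun x => f x - g x)) = 0 /\
    ip (im_fun (fun x => f x - g x)) (im_fun (fun x => f x - g x)) = 0 by split; lra.
apply: aeS (aeI (ip_eq0_ae r rE) (ip_eq0_ae i iE)) => x.
rewrite re_funB im_funB => -[/eqP + /eqP]; rewrite !subr_eq0 => /eqP a /eqP b.
exact: re_im_inj.
Qed.

Lemma is_fourier_integral f : in_Lp 1%:E f -> in_Lp 2%:E f ->
  is_fourier f (fourier_integral f).
Proof.
move=> l1 l2; have [_ lF] := fourier_integral_plancherel_le l1 l2.
split => //; exists (fun=> f); split=> //.
- rewrite (_ : cLnorm _ _ = 0%E); first exact: cvg_cst.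
  rewrite -[RHS](@Lnorm0 _ _ R mu 2%:E)//; apply: eq_Lnorm => x.
  by rewrite subrr /modulus /= expr0n addr0 sqrtr0.
- rewrite (_ : cLnorm _ _ = 0%E); first exact: cvg_cst.
  rewrite -[RHS](@Lnorm0 _ _ R mu 2%:E)//; apply: eq_Lnorm => x.
  by rewrite subrr /modulus /= expr0n addr0 sqrtr0.
Qed.

(** The transforms of the approximants u_m tend to g by definition, and to the Fourier integral of f
    because the transform is a contraction on L1 and L2. *)
Lemma is_fourier_unique f g : in_Lp 1%:E f -> in_Lp 2%:E f -> is_fourier f g ->
  {ae mu, forall x, g x = fourier_integral f x}.
Proof.
move=> l1 l2 [lg [u [lu uf ug]]].
have [_ lF] := fourier_integral_plancherel_le l1 l2.
apply: sqnorm_eq0_ae => // e e0.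
have e4 : 0 < e / 4 by rewrite divr_gt0.
have [N _ HN] := cLnorm_cvg0_sqnorm e4 uf.
have [M _ HM] := cLnorm_cvg0_sqnorm e4 ug.
pose m := maxn N M.
have {}HN := HN m (leq_maxl _ _); have {}HM := HM m (leq_maxr _ _).
have [lu1 lu2] := lu m.
have [_ lFu] := fourier_integral_plancherel_le lu1 lu2.
apply: (le_trans (sqnorm_triangle lg lF lFu)).
have S : sqnorm (fun x => g x - fourier_integral (u m) x) =
    sqnorm (fun x => fourier_integral (u m) x - g x).
  apply: eq_integral => x _; congr EFin; rewrite !re_funB !im_funB.
  by congr (_ + _); rewrite -sqrrN opprB.
have P : (sqnorm (fun x => fourier_integral (u m) x - fourier_integral f x)%R <= (e / 4)%:E)%E.
  rewrite -fourier_integralB//; apply: le_trans HN.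
  have l1' := in_Lp1B lu1 l1; have l2' := in_Lp2B lu2 l2.
  by have [] := fourier_integral_plancherel_le l1' l2'.
rewrite S (_ : e%:E = 2%:E * ((e / 4)%:E + (e / 4)%:E))%E; last first.
  by rewrite -EFinD -EFinM; congr EFin; field.
by rewrite lee_pmul2l//; apply: leeD.
Qed.

(** The choice is not the default value, because the Fourier integral is a witness; uniqueness then
    identifies what was chosen. *)
Lemma fourier_ae f : in_Lp 1%:E f -> in_Lp 2%:E f ->
  in_Lp 2%:E (fourier f) /\ {ae mu, forall x, fourier f x = fourier_integral f x}.
Proof.
move=> l1 l2.
have : is_fourier f (fourier f).
  rewrite /fourier; case: xgetP => [g _ //|/(_ (fourier_integral f))].
  by case; exact: is_fourier_integral.
by move=> F; split; [case: F|exact: is_fourier_unique].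
Qed.

End FourierL2.

(** * Dispersions of one function *)

Section Uncertainty.
Context {R : realType}.
Implicit Types f g : R -> R[i].
Implicit Types u v : R -> R.
Local Notation mu := (@lebesgue_measure R).
Local Notation h := (@hermite_fun R).
Local Notation lam := (@hermite_eigenvalue R).

Lemma L1_oneDsqrV : L1 (fun x : R => (oneDsqr x)^-1).
Proof.
have p0 (x : R) : 0 <= (oneDsqr x)^-1 by rewrite invr_ge0 (le_trans ler01)// oneDsqr_ge1.
have cV : continuous (fun x : R => (oneDsqr x)^-1) by exact: continuous_oneDsqrV.
apply/integrableP; split.
  by apply/measurable_EFinP; exact: continuous_measurable_fun.
under eq_integral do rewrite /= ger0_norm//.
rewrite ge0_symfun_integralT//; last by move=> x; rewrite /= /oneDsqr sqrrN.
by rewrite -set_itvcy integral0y_oneDsqr -EFinM ltry.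
Qed.

(** Pointwise |u| <= (1 + x^2) u^2 + 1 / (1 + x^2). This makes the Fourier integral available as
    soon as the second moment is finite. *)
Lemma sqint_mulX_L1 u : sqint u -> sqint (fun t => t * u t) -> L1 u.
Proof.
move=> lu ltu; have [mu1 u2] := lu; have [_ tu2] := ltu.
apply: (L1_le mu1 _ (L1D (L1D u2 tu2) L1_oneDsqrV)) => x.
have d0 : 0 < oneDsqr x by rewrite (lt_le_trans ltr01)// oneDsqr_ge1.
have -> : u x ^+ 2 + (x * u x) ^+ 2 = oneDsqr x * `|u x| ^+ 2.
  by rewrite real_normK ?num_real// /oneDsqr; ring.
have i0 : 0 < (oneDsqr x)^-1 by rewrite invr_gt0.
have di : oneDsqr x * (oneDsqr x)^-1 = 1 by rewrite mulfV// gt_eqF.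
move: (oneDsqr x) (oneDsqr x)^-1 (`|u x|) (normr_ge0 (u x)) d0 i0 di => d i y y0 d0 i0 di.
rewrite -(ler_pM2l d0) mulrDr di -subr_ge0.
(* Completing the square in (d y)^2 - d y + 1. *)
rewrite (_ : _ - _ = (d * y - 2^-1) ^+ 2 + 3 / 4); last by field.
by rewrite addr_ge0 ?sqr_ge0.
Qed.

Lemma ge0_lty_L1 (r : R -> R) : measurable_fun [set: R] r -> (forall t, 0 <= r t) ->
  (\int[mu]_t (r t)%:E < +oo)%E -> L1 r.
Proof.
move=> mr r0 roo; apply/integrableP; split; first exact/measurable_EFinP.
by under eq_integral do rewrite /= ger0_norm//.
Qed.

Definition moment2 f : \bar R :=
  (\int[mu]_t (t ^+ 2 * (re_fun f t ^+ 2 + im_fun f t ^+ 2))%:E)%E.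

Lemma moment2_ge0 f : (0 <= moment2 f)%E.
Proof.
by apply: integral_ge0 => t _; rewrite lee_fin mulr_ge0 ?addr_ge0 ?sqr_ge0.
Qed.

(** Expansion of the square when the second moment is finite. Otherwise m may be a default value,
    but t^2 <= 2 (t - m)^2 + 2 m^2 holds for any m, so the left side is infinite too. *)
Lemma variance_mean (r : R -> R) : L1 r -> (forall t, 0 <= r t) ->
  \int[mu]_t r t = 1 ->
  let m := \int[mu]_t (t * r t) in
  (\int[mu]_t (`|t - m| ^+ 2 * r t)%:E + (`|m| ^+ 2)%:E =
   \int[mu]_t (t ^+ 2 * r t)%:E)%E.
Proof.
move=> lr r0 r1 m; have mr := L1_measurable lr.
have absE t : `|t - m| ^+ 2 * r t = t ^+ 2 * r t - 2 * m * (t * r t) + m ^+ 2 * r t.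
  by rewrite real_normK ?num_real//; ring.
have mV : measurable_fun [set: R] (fun t => `|t - m| ^+ 2 * r t).
  apply: measurable_funM => //; apply: measurable_funX.
  by apply: measurableT_comp => //; exact: measurable_funB.
have mM : measurable_fun [set: R] (fun t => t ^+ 2 * r t).
  by apply: measurable_funM => //; exact: measurable_funX.
have [M_oo|] := ltP (\int[mu]_t (t ^+ 2 * r t)%:E)%E +oo%E; last first.
  rewrite leye_eq => /eqP M_oo; rewrite M_oo.
  have [V_oo|] := ltP (\int[mu]_t (`|t - m| ^+ 2 * r t)%:E)%E +oo%E; last first.
    by rewrite leye_eq => /eqP ->.
  have lV : L1 (fun t => `|t - m| ^+ 2 * r t).
    by apply: ge0_lty_L1 => // t; rewrite mulr_ge0// sqr_ge0.
  have : L1 (fun t => t ^+ 2 * r t).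
    apply: (L1_le mM _ (L1D (L1Z 2 lV) (L1Z (2 * m ^+ 2) lr))) => t.
    rewrite ger0_norm; last by apply: mulr_ge0; rewrite ?sqr_ge0.
    rewrite [X in _ <= X + _]mulrA -mulrDl ler_wpM2r//.
    rewrite real_normK ?num_real// -subr_ge0 (_ : _ - _ = (t - 2 * m) ^+ 2); last by ring.
    exact: sqr_ge0.
  by move=> /Rintegral_fin; rewrite M_oo.
have lM : L1 (fun t => t ^+ 2 * r t).
  by apply: ge0_lty_L1 => // t; rewrite mulr_ge0// sqr_ge0.
have lt : L1 (fun t => t * r t).
  apply: (L1_le _ _ (L1D lM lr)); first exact: measurable_funM.
  move=> t; rewrite normrM (ger0_norm (r0 t)) -[X in _ <= _ + X]mul1r -mulrDl.
  rewrite ler_wpM2r// -(real_normK (num_real t)); have := normr_ge0 t; nra.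
under eq_integral do rewrite absE.
rewrite Rintegral_fin; last by apply: L1D; [apply: L1B => //; exact: L1Z|exact: L1Z].
rewrite (Rintegral_fin lM) -EFinD; congr EFin.
rewrite RintegralD//; [|apply: L1B => //; exact: L1Z|exact: L1Z].
rewrite RintegralB//; last exact: L1Z.
have E1 : \int[mu]_t (2 * m * (t * r t)) = 2 * m * m by rewrite RintegralZl.
have E2 : \int[mu]_t (m ^+ 2 * r t) = m ^+ 2 by rewrite RintegralZl// r1 mulr1.
by rewrite E1 E2 real_normK ?num_real//; ring.
Qed.

Lemma dispersion_sq_mean f : in_Lp 2%:E f -> sqnorm f = 1%E ->
  (dispersion_sq f + (`|mean f| ^+ 2)%:E = moment2 f)%E.
Proof.
move=> /in_Lp2P[lr li] f1.
pose r t := re_fun f t ^+ 2 + im_fun f t ^+ 2.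
have modE t : modulus (f t) ^+ 2 = r t by rewrite modulus_sqr.
have lR : L1 r by exact: L1D lr.2 li.2.
have r0 t : 0 <= r t by rewrite addr_ge0 ?sqr_ge0.
have r1 : \int[mu]_t r t = 1 by rewrite /Rintegral -/(sqnorm f) f1.
rewrite /dispersion_sq; have -> : mean f = \int[mu]_t (t * r t).
  rewrite /mean; under eq_Rintegral do rewrite modE.
  by rewrite r1 invr1 mul1r; apply: eq_Rintegral => t _; rewrite modE.
under eq_integral do rewrite modE.
exact: variance_mean.
Qed.

Lemma dispersion_sq_ge0 f : (0 <= dispersion_sq f)%E.
Proof. by apply: integral_ge0 => t _; rewrite lee_fin mulr_ge0 ?sqr_ge0. Qed.

(** This is |<f, h_j>|^2, as h_j is real. *)
Definition hermite_weight f (j : nat) : R :=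
  ip (re_fun f) (h j) ^+ 2 + ip (im_fun f) (h j) ^+ 2.

Definition uncertainty f : \bar R :=
  (dispersion_sq f + dispersion_sq (fourier f)
   + (`|mean f| ^+ 2)%:E + (`|mean (fourier f)| ^+ 2)%:E)%E.

Lemma uncertaintyE f : uncertainty f = ((dispersion_sq f + (`|mean f| ^+ 2)%:E) +
  (dispersion_sq (fourier f) + (`|mean (fourier f)| ^+ 2)%:E))%E.
Proof. by rewrite /uncertainty -addeA addeACA. Qed.

(** The transform changes Hermite coefficients by signs only. Bessel for Hu therefore bounds the
    partial sums of u, which converge to the norm of u by Parseval. *)
Lemma hartley_plancherel u : L1 u -> sqint u ->
  ip (hartley u) (hartley u) = ip u u.
Proof.
move=> lu l2u; have [lH H] := hartley_plancherel_le lu l2u.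
apply/eqP; rewrite eq_le H /=.
apply: (cvgr_to_le (hermite_parseval l2u)); apply: nearW => n.
apply: le_trans (bessel (@sqint_hermite_fun R) hermite_orthonormal n lH).
rewrite le_eqVlt; apply/orP; left; apply/eqP; apply: eq_bigr => i _.
by rewrite ip_hartley_hermite// exprMn hartley_sign_sqr mul1r.
Qed.

Lemma moment2_fin f : in_Lp 2%:E f -> (moment2 f < +oo)%E ->
  [/\ sqint (fun t => t * re_fun f t), sqint (fun t => t * im_fun f t) &
   moment2 f = (ip (fun t => t * re_fun f t) (fun t => t * re_fun f t) +
     ip (fun t => t * im_fun f t) (fun t => t * im_fun f t))%:E].
Proof.
move=> /in_Lp2P[[mr _] [mi _]].
pose tf t : R[i] := (t * re_fun f t) +i* (t * im_fun f t).
have E : moment2 f = sqnorm tf.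
  by apply: eq_integral => t _; congr EFin; rewrite /tf /re_fun /im_fun /=; ring.
rewrite E => oo; have [] := sqnorm_lty _ oo.
  by split; apply: measurable_funM.
by move=> l1 l2; split => //; rewrite sqnorm_fin.
Qed.

(** If either second moment is infinite, so is the right side. Otherwise the bound is [energy_ge]
    for the real and the imaginary part, added up. *)
Lemma uncertainty_ge f J : in_Lp 2%:E f -> sqnorm f = 1%E ->
  ((\sum_(j < J) lam j * hermite_weight f j)%:E <= uncertainty f)%E.
Proof.
move=> l2f f1; have [l2u l2v] := (in_Lp2P f).1 l2f.
rewrite uncertaintyE dispersion_sq_mean//.
have [oo|] := ltP (moment2 f) +oo%E; last first.
  rewrite leye_eq => /eqP ->; rewrite addye ?leey//.
  by rewrite gt_eqF// (lt_le_trans ltNy0)// adde_ge0 ?dispersion_sq_ge0// lee_fin sqr_ge0.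
have [ltu ltv Ef] := moment2_fin l2f oo.
have lu := sqint_mulX_L1 l2u ltu; have lv := sqint_mulX_L1 l2v ltv.
have l1f : in_Lp 1%:E f by apply/in_Lp1P.
have [l2g gE] := fourier_ae l1f l2f.
have mF := cmeasurable_fourier_integral lu lv.
have [mgr mgi] := proj1 l2g; have [mFr mFi] := mF.
have int_ae (w : R -> R) : measurable_fun [set: R] w -> (forall x, 0 <= w x) ->
  (\int[mu]_t (w t * (re_fun (fourier f) t ^+ 2 + im_fun (fourier f) t ^+ 2))%:E =
   \int[mu]_t (w t * (re_fun (fourier_integral f) t ^+ 2 +
      im_fun (fourier_integral f) t ^+ 2))%:E)%E.
  move=> mw w0; apply: ge0_ae_eq_integral => //.
  - apply/measurable_EFinP; apply: measurable_funM => //.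
    by apply: measurable_funD; exact: measurable_funX.
  - apply/measurable_EFinP; apply: measurable_funM => //.
    by apply: measurable_funD; exact: measurable_funX.
  - by move=> t _; rewrite lee_fin mulr_ge0// addr_ge0 ?sqr_ge0.
  - by move=> t _; rewrite lee_fin mulr_ge0// addr_ge0 ?sqr_ge0.
  - by apply: aeS gE => t E _; rewrite /re_fun /im_fun E.
have [lHu _] := hartley_plancherel_le lu l2u.
have [lHv _] := hartley_plancherel_le lv l2v.
(* The transform must be a unit vector before its variance and mean can be merged; here equality in
   Plancherel is used. *)
have g1 : sqnorm (fourier f) = 1%E.
  have := int_ae (fun=> 1) (measurable_cst _) (fun=> ler01).
  under eq_integral do rewrite mul1r.
  under [X in _ = X -> _]eq_integral do rewrite mul1r.
  rewrite -/(sqnorm _) -/(sqnorm _) => ->.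
  rewrite sqnorm_fourier_integral//.
  apply: (eq_trans (@sqnorm_fin R (fun xi =>
    hartley (re_fun f) xi +i* hartley (im_fun f) xi) lHu lHv)).
  rewrite -[RHS]f1 (sqnorm_fin l2u l2v).
  by rewrite -(hartley_plancherel lu l2u) -(hartley_plancherel lv l2v).
rewrite dispersion_sq_mean//.
(* The weight t^2 is even, so the symmetrisation applies and leaves the two Hartley transforms. *)
have Mg : moment2 (fourier f) =
    moment2 (fun xi => hartley (re_fun f) xi +i* hartley (im_fun f) xi).
  have mw : measurable_fun [set: R] (fun t : R => t ^+ 2) by exact: measurable_funX.
  have w0 (t : R) : 0 <= t ^+ 2 by exact: sqr_ge0.
  have wN (t : R) : (- t) ^+ 2 = t ^+ 2 by rewrite sqrrN.
  exact: (eq_trans (int_ae _ mw w0) (fourier_integral_even_weight lu lv mw w0 wN)).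
rewrite Mg.
have [oo2|] := ltP (moment2 (fun xi => hartley (re_fun f) xi +i* hartley (im_fun f) xi)) +oo%E; last first.
  rewrite leye_eq => /eqP ->; rewrite addey ?leey//.
  by rewrite gt_eqF// (lt_le_trans ltNy0)// moment2_ge0.
have l2H : in_Lp 2%:E (fun xi => hartley (re_fun f) xi +i* hartley (im_fun f) xi).
  exact/in_Lp2P.
have [lxu lxv Eg] := moment2_fin l2H oo2.
rewrite Ef Eg -EFinD lee_fin.
have H1 := energy_ge J lu l2u ltu lxu; have H2 := energy_ge J lv l2v ltv lxv.
rewrite /hermite_weight; under eq_bigr do rewrite mulrDr.
rewrite big_split /=; apply: (le_trans (lerD H1 H2)).
by rewrite addrACA.
Qed.

Lemma hermite_weight_cvg f : in_Lp 2%:E f -> sqnorm f = 1%E ->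
  (fun J => \sum_(j < J) hermite_weight f j) @ \oo --> (1 : R).
Proof.
move=> /in_Lp2P[lu lv]; rewrite sqnorm_fin// => -[<-].
rewrite (_ : (fun J => \sum_(j < J) _) = fun J => \sum_(j < J) ip (re_fun f) (h j) ^+ 2 +
    \sum_(j < J) ip (im_fun f) (h j) ^+ 2); last first.
  by apply/funext => J; rewrite -big_split.
exact: cvgD (hermite_parseval lu) (hermite_parseval lv).
Qed.

Lemma hermite_eigenvalue_le i j : (i <= j)%N -> lam i <= lam j.
Proof.
move=> ij; rewrite ler_wpM2r ?invr_ge0 ?mulr_ge0 ?pi_ge0// lerD2r ler_wpM2l//.
by rewrite ler_nat.
Qed.

(** For j >= N each weight counts with at least lam_N, and all weights together have mass 1; the
    bound at finite J then passes to the limit. *)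
Lemma uncertainty_ge_gap f N : in_Lp 2%:E f -> sqnorm f = 1%E ->
  ((lam N - \sum_(j < N) (lam N - lam j) * hermite_weight f j)%:E <= uncertainty f)%E.
Proof.
move=> l2f f1; have c0 j : 0 <= hermite_weight f j by rewrite addr_ge0 ?sqr_ge0.
have := fun J => @uncertainty_ge f J l2f f1.
(* The value -oo is excluded by the empty sum J = 0. *)
case: (uncertainty f) => [T HT| |/(_ 0)]//; last by rewrite leey.
rewrite lee_fin lerBlDr.
have lim : (fun J => lam N * \sum_(j < J) hermite_weight f j) @ \oo --> lam N.
  rewrite -[X in _ --> X]mulr1; apply: cvgM; first exact: cvg_cst.
  exact: hermite_weight_cvg.
apply: (cvgr_to_le lim); near=> J.
have NJ : (N <= J)%N by near: J; exists N.
have HJ : \sum_(j < J) lam j * hermite_weight f j <= T by have := HT J; rewrite lee_fin.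
rewrite -lerBlDr in HJ *; apply: le_trans HJ.
rewrite -(subnKC NJ); elim: (J - N)%N => [|k IH].
  rewrite addn0 mulr_sumr -sumrB le_eqVlt; apply/orP; left; apply/eqP.
  by apply: eq_bigr => j _; ring.
rewrite addnS !big_ord_recr /= mulrDr -addrAC.
rewrite lerD// ler_wpM2r// hermite_eigenvalue_le// leq_addr.
Unshelve. all: by end_near. Qed.

End Uncertainty.

(** * Orthonormal sequences *)

Section Main.
Context {R : realType}.
Implicit Types f g : R -> R[i].
Local Notation mu := (@lebesgue_measure R).
Local Notation h := (@hermite_fun R).
Local Notation lam := (@hermite_eigenvalue R).

(** Bessel's inequality for the complex orthonormal family u_k + i v_k and a real w, the two
    hypotheses being the real and imaginary parts of orthonormality. *)
Lemma complex_bessel n (u v : nat -> R -> R) (w : R -> R) :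
  (forall k, sqint (u k)) -> (forall k, sqint (v k)) -> sqint w ->
  (forall j k, ip (u j) (u k) + ip (v j) (v k) = (j == k)%:R) ->
  (forall j k, ip (v j) (u k) = ip (u j) (v k)) ->
  \sum_(k < n) (ip (u k) w ^+ 2 + ip (v k) w ^+ 2) <= ip w w.
Proof.
move=> lu lv lw uv1 uv2.
pose a k := ip (u k) w; pose b k := ip (v k) w.
(* P_k + i Q_k = <w, e_k> e_k with e_k = u_k + i v_k, so p + i q is the projection of w. *)
pose P k (x : R) := a k * u k x + b k * v k x.
pose Q k (x : R) := a k * v k x - b k * u k x.
have lP k : sqint (P k) by apply: sqintD; exact: sqintZ.
have lQ k : sqint (Q k) by apply: sqintB; exact: sqintZ.
pose p x := \sum_(k < n) P k x; pose q x := \sum_(k < n) Q k x.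
have lp : sqint p by exact: (@sqint_sum R n P lP).
have lq : sqint q by exact: (@sqint_sum R n Q lQ).
set S := \sum_(k < n) _.
have pw : ip p w = S.
  rewrite ipC (@ip_sumr R n w P)//; apply: eq_bigr => k _.
  rewrite (ipDr lw (sqintZ (a k) (lu k)) (sqintZ (b k) (lv k))) !ipZr// !(ipC w).
  by rewrite -/(a k) -/(b k) !expr2.
have PQ j k : ip (P j) (P k) + ip (Q j) (Q k) = (a j * a k + b j * b k) * (j == k)%:R.
  have lau i := sqintZ (a i) (lu i); have lbv i := sqintZ (b i) (lv i).
  have lav i := sqintZ (a i) (lv i); have lbu i := sqintZ (b i) (lu i).
  rewrite (ipDl (lau j) (lbv j) (lP k)) (ipDr (lau j) (lau k) (lbv k)).
  rewrite (ipDr (lbv j) (lau k) (lbv k)) (ipBl (lav j) (lbu j) (lQ k)).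
  rewrite (ipBr (lav j) (lav k) (lbu k)) (ipBr (lbu j) (lav k) (lbu k)).
  rewrite !ipZl// !ipZr// uv2 -uv1; ring.
have pq : ip p p + ip q q = S.
  rewrite (@ip_sumr R n p P)// (@ip_sumr R n q Q)// -big_split /=.
  apply: eq_bigr => k _; rewrite (ipC p) (ipC q) (@ip_sumr R n _ P)// (@ip_sumr R n _ Q)//.
  rewrite -big_split /= (bigD1 k)//= PQ eqxx mulr1 big1 ?addr0 ?expr2//.
  by move=> i ik; rewrite PQ eq_sym (negbTE (ik : i != k :> nat)) mulr0.
have := ip_ge0 (fun x => w x - p x); have := ip_ge0 q.
rewrite (ipBl lw lp (sqintB lw lp)) (ipBr lw lw lp) (ipBr lp lw lp) (ipC w p) pw.
by move: pq; lra.
Qed.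

Lemma Re_inner f g : in_Lp 2%:E f -> in_Lp 2%:E g -> complex.Re (inner f g) =
  ip (re_fun f) (re_fun g) + ip (im_fun f) (im_fun g).
Proof.
move=> /in_Lp2P[fr fi] /in_Lp2P[gr gi].
rewrite /ip -RintegralD//; try exact: sqintM.
apply: eq_Rintegral => t _; rewrite /re_fun /im_fun.
by case: (f t) => a b; case: (g t) => c d /=; ring.
Qed.

Lemma Im_inner f g : in_Lp 2%:E f -> in_Lp 2%:E g -> complex.Im (inner f g) =
  ip (im_fun f) (re_fun g) - ip (re_fun f) (im_fun g).
Proof.
move=> /in_Lp2P[fr fi] /in_Lp2P[gr gi].
rewrite /ip -RintegralB//; try exact: sqintM.
apply: eq_Rintegral => t _; rewrite /re_fun /im_fun.
by case: (f t) => a b; case: (g t) => c d /=; ring.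
Qed.

(** In the equality case the earlier e_j are known to be multiples of h_j; orthogonality then
    removes the corresponding weights of e_k. *)
Lemma inner_ae_hermite f g (c : R[i]) j : in_Lp 2%:E f -> in_Lp 2%:E g ->
  inner f g = 0 -> c != 0 -> {ae mu, forall t, g t = c * (h j t)%:C} ->
  hermite_weight f j = 0.
Proof.
move=> lf lg fg0 c0 gE.
have [fr fi] := (in_Lp2P f).1 lf; have [gr gi] := (in_Lp2P g).1 lg.
have R0 := Re_inner lf lg; have I0 := Im_inner lf lg.
rewrite fg0 /= in R0 I0.
case: c c0 gE => p q c0 gE.
have lh := @sqint_hermite_fun R j.
have gipr u : sqint u -> ip u (re_fun g) = p * ip u (h j).
  move=> lu; rewrite -ipZr//; congr fine; apply: ae_eq_integral => //.
  - by apply/measurable_EFinP; apply: measurable_funM; [case: lu|case: gr].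
  - by apply/measurable_EFinP; apply: measurable_funM; [case: lu|apply: measurable_funM => //; case: lh].
  - by apply: aeS gE => t E _; rewrite /re_fun E /=; congr EFin; ring.
have gipi u : sqint u -> ip u (im_fun g) = q * ip u (h j).
  move=> lu; rewrite -ipZr//; congr fine; apply: ae_eq_integral => //.
  - by apply/measurable_EFinP; apply: measurable_funM; [case: lu|case: gi].
  - by apply/measurable_EFinP; apply: measurable_funM; [case: lu|apply: measurable_funM => //; case: lh].
  - by apply: aeS gE => t E _; rewrite /im_fun E /=; congr EFin; ring.
rewrite !gipr// !gipi// in R0 I0.
have pq : p ^+ 2 + q ^+ 2 != 0.
  apply: contra c0; rewrite paddr_eq0 ?sqr_ge0// !sqrf_eq0 => /andP[/eqP -> /eqP ->].
  by [].
apply: (mulfI pq); rewrite mulr0 /hermite_weight.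
set A := ip (re_fun f) (h j) in R0 I0 *; set B := ip (im_fun f) (h j) in R0 I0 *.
(* Multiplicativity of the complex modulus; the two squares on the right are the real and imaginary
   parts of the inner product. *)
have lagrange (x y z w : R) : (x ^+ 2 + y ^+ 2) * (z ^+ 2 + w ^+ 2) =
  (x * z + y * w) ^+ 2 + (x * w - y * z) ^+ 2 by ring.
by rewrite lagrange -R0 -I0 expr0n addr0.
Qed.

(** The equality case of Bessel: the residuals of both parts along h_k have total squared norm 1
    minus the weight, hence 0, and c is the coefficient <f, h_k>. *)
Lemma hermite_weight_eq1 f k : in_Lp 2%:E f -> sqnorm f = 1%E ->
  1 <= hermite_weight f k ->
  exists c : R[i], `|c| = 1 /\ {ae mu, forall t, f t = c * (h k t)%:C}.
Proof.
move=> lf f1 w1; have [fr fi] := (in_Lp2P f).1 lf.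
have lh := @sqint_hermite_fun R k.
set A := ip (re_fun f) (h k); set B := ip (im_fun f) (h k).
have res (u : R -> R) : sqint u ->
    ip (fun x => u x - ip u (h k) * h k x) (fun x => u x - ip u (h k) * h k x) =
    ip u u - ip u (h k) ^+ 2.
  move=> lu; have lch := sqintZ (ip u (h k)) lh.
  rewrite (ipBl lu lch (sqintB lu lch)) (ipBr lu lu lch) (ipBr lch lu lch).
  have hh : ip (h k) (h k) = 1 by rewrite hermite_orthonormal eqxx.
  by rewrite !ipZl// !ipZr// (ipC (h k) u) hh; ring.
have Er := res _ fr; have Ei := res _ fi.
have r0 := ip_ge0 (fun x => re_fun f x - A * h k x).
have i0 := ip_ge0 (fun x => im_fun f x - B * h k x).
have S1 : ip (re_fun f) (re_fun f) + ip (im_fun f) (im_fun f) = 1.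
  by move: f1; rewrite sqnorm_fin// => -[].
rewrite -/A in Er; rewrite -/B in Ei; rewrite /hermite_weight -/A -/B in w1.
have ABle : A ^+ 2 + B ^+ 2 = 1 by move: r0 i0 w1 S1; rewrite Er Ei; lra.
have zr : ip (fun x => re_fun f x - A * h k x) (fun x => re_fun f x - A * h k x) = 0.
  by move: r0 i0; rewrite Er Ei; lra.
have zi : ip (fun x => im_fun f x - B * h k x) (fun x => im_fun f x - B * h k x) = 0.
  by move: r0 i0; rewrite Er Ei; lra.
exists (A +i* B); split.
  by rewrite normc_def /= ABle sqrtr1.
have lr := sqintB fr (sqintZ A lh); have li := sqintB fi (sqintZ B lh).
apply: aeS (aeI (ip_eq0_ae lr zr) (ip_eq0_ae li zi)) => t [] /eqP + /eqP.
rewrite !subr_eq0 => /eqP E1 /eqP E2; apply: re_im_inj.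
  by rewrite -[LHS]/(re_fun f t) E1 /=; ring.
by rewrite -[LHS]/(im_fun f t) E2 /=; ring.
Qed.

Lemma sum_hermite_eigenvalue n : \sum_(j < n.+1) lam j = (n%:R + 1) ^+ 2 / (2 * pi).
Proof.
rewrite /hermite_eigenvalue -mulr_suml; congr (_ / _).
elim: n => [|n IH]; first by rewrite big_ord1 /=; ring.
by rewrite big_ord_recr IH /= -!natr1; ring.
Qed.

(** * Summation over the sequence and the equality case *)

Section OrthonormalSequence.
Variable e : nat -> R -> R[i].
Hypothesis he : orthonormal_seq e.

Lemma orthonormal_in_Lp2 k : in_Lp 2%:E (e k). Proof. exact: he.1. Qed.

Lemma orthonormal_re j k : ip (re_fun (e j)) (re_fun (e k)) +
  ip (im_fun (e j)) (im_fun (e k)) = (j == k)%:R.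
Proof.
have := Re_inner (orthonormal_in_Lp2 j) (orthonormal_in_Lp2 k).
by rewrite he.2 => <-; case: (j == k).
Qed.

Lemma orthonormal_im j k : ip (im_fun (e j)) (re_fun (e k)) =
  ip (re_fun (e j)) (im_fun (e k)).
Proof.
have := Im_inner (orthonormal_in_Lp2 j) (orthonormal_in_Lp2 k).
rewrite he.2 => /esym/eqP; rewrite (_ : complex.Im _ = 0); last by case: (j == k).
by rewrite subr_eq0 => /eqP.
Qed.

Lemma orthonormal_sqnorm k : sqnorm (e k) = 1%E.
Proof.
have [lr li] := (in_Lp2P _).1 (orthonormal_in_Lp2 k).
by rewrite sqnorm_fin// orthonormal_re eqxx.
Qed.

Lemma sum_hermite_weight_le n j : \sum_(k < n) hermite_weight (e k) j <= 1.
Proof.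
have L k := (in_Lp2P _).1 (orthonormal_in_Lp2 k).
have := @complex_bessel n (fun k => re_fun (e k)) (fun k => im_fun (e k)) (h j)
  (fun k => (L k).1) (fun k => (L k).2) (sqint_hermite_fun j)
  orthonormal_re orthonormal_im.
by rewrite hermite_orthonormal eqxx.
Qed.

Lemma sum_uncertainty_ge n :
  (((n%:R + 1) ^+ 2 / (2 * pi))%:E <= \sum_(0 <= k < n.+1) uncertainty (e k))%E.
Proof.
(* There are as many functions as modes below n + 1, so after Bessel the n + 1 copies of lam_(n+1)
   cancel and the sum of the lam_j remains. *)
pose L k := lam n.+1 - \sum_(j < n.+1) (lam n.+1 - lam j) * hermite_weight (e k) j.
apply: (@le_trans _ _ (\sum_(0 <= k < n.+1) (L k)%:E)%E); last first.
  apply: lee_sum => k _.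
  by apply: uncertainty_ge_gap; [exact: orthonormal_in_Lp2|exact: orthonormal_sqnorm].
rewrite sumEFin lee_fin big_mkord /L -sum_hermite_eigenvalue.
rewrite sumrB exchange_big /= sumr_const card_ord.
under [in X in _ <= _ - X]eq_bigr do rewrite -mulr_sumr.
rewrite lerBrDr -mulr_natl -lerBrDl.
apply: (@le_trans _ _ (\sum_(j < n.+1) (lam n.+1 - lam j))).
  apply: ler_sum => j _; rewrite ler_piMr ?sum_hermite_weight_le//.
  by rewrite subr_ge0 hermite_eigenvalue_le// ltnW.
by rewrite sumrB sumr_const card_ord mulr_natl.
Qed.

(** Consecutive squares differ by odd numbers, so subtracting successive equalities isolates each
    term. *)
Lemma sum_uncertainty_eq n0 :
  (forall n, (n <= n0)%N -> (\sum_(0 <= k < n.+1) uncertainty (e k))%E =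
    ((n%:R + 1) ^+ 2 / (2 * pi))%:E) ->
  forall k, (k <= n0)%N -> uncertainty (e k) = (lam k)%:E.
Proof.
move=> H [|k] k0.
  by have := H 0 k0; rewrite big_nat1 => ->; congr EFin; rewrite /hermite_eigenvalue; congr (_ / _); ring.
have := H k.+1 k0; rewrite big_nat_recr//= (H k (ltnW k0)).
case: (uncertainty (e k.+1)) => [T| |]//= [] E.
have kS : k.+1%:R = k%:R + 1 :> R by rewrite natr1.
congr EFin; rewrite /hermite_eigenvalue kS; rewrite kS in E.
apply: (@addrI _ ((k%:R + 1) ^+ 2 / (2 * pi))); rewrite E -mulrDl; congr (_ / _); ring.
Qed.

(** By strong induction the weights of e_k on the modes j < k vanish. The gap bound then involves
    mode k alone, and since lam_(k+1) > lam_k it forces that weight to be at least 1. *)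
Lemma uncertainty_eq_hermite n0 :
  (forall k, (k <= n0)%N -> uncertainty (e k) = (lam k)%:E) ->
  forall k, (k <= n0)%N -> exists c : R[i], `|c| = 1 /\
    {ae mu, forall t, e k t = c * (h k t)%:C}.
Proof.
move=> H k; elim/ltn_ind: k => k IH k0.
apply: hermite_weight_eq1; [exact: orthonormal_in_Lp2|exact: orthonormal_sqnorm|].
have := uncertainty_ge_gap k.+1 (orthonormal_in_Lp2 k) (orthonormal_sqnorm k).
rewrite H// lee_fin big_ord_recr /= big1 ?add0r => [|j _]; last first.
  have jk : (j < k)%N by exact: ltn_ord.
  have [c [c1 cE]] := IH j jk (leq_trans (ltnW jk) k0).
  rewrite (inner_ae_hermite (orthonormal_in_Lp2 k) (orthonormal_in_Lp2 j) _ _ cE) ?mulr0//.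
    by rewrite he.2 gtn_eqF.
  by rewrite -normr_eq0 c1 oner_eq0.
have d0 : 0 < lam k.+1 - lam k.
  rewrite /hermite_eigenvalue -mulrBl divr_gt0//; last by rewrite mulr_gt0// pi_gt0.
  by rewrite -natr1; lra.
rewrite lerBlDr -lerBlDl => H1.
by rewrite -(ler_pM2l d0) mulr1.
Qed.

End OrthonormalSequence.
End Main.

Theorem mainTheorem1 (R : realType) (e : nat -> R -> R[i])
    (he : orthonormal_seq e) :
  (forall n : nat,
    (((n%:R + 1) ^+ 2 / (2 * pi))%:E <=
      \sum_(0 <= k < n.+1)
        (dispersion_sq (e k) + dispersion_sq (fourier (e k))
         + (`|mean (e k)| ^+ 2)%:E + (`|mean (fourier (e k))| ^+ 2)%:E))%E) /\
  (forall n0 : nat,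
    (forall n : nat, (n <= n0)%N ->
      (\sum_(0 <= k < n.+1)
        (dispersion_sq (e k) + dispersion_sq (fourier (e k))
         + (`|mean (e k)| ^+ 2)%:E + (`|mean (fourier (e k))| ^+ 2)%:E))%E
      = ((n%:R + 1) ^+ 2 / (2 * pi))%:E) ->
    forall k : nat, (k <= n0)%N ->
      exists c : R[i], `|c| = 1 /\
        {ae @lebesgue_measure R,
          forall t : R, e k t = c * (hermite_fun k t)%:C}).
Proof.
split=> [n|n0 H]; first exact: sum_uncertainty_ge.
exact: (uncertainty_eq_hermite he (sum_uncertainty_eq H)).
Qed.
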